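(* Let $\mathcal{G}$ be a strongly effective, ample, Hausdorff groupoid and let $K$ be a field. Let $\mathcal{B}$ be a basis for the topology of $\mathcal{G}^{(0)}$ consisting of nonempty compact open sets. Then the following are equivalent: (1) $A_K(\mathcal{G})$ is properly purely infinite. (2) For every $V\in\mathcal{B}$, $1_V$ is properly infinite in $A_K(\mathcal{G})$. (3) For every invariant open subset $U\subseteq\mathcal{G}^{(0)}$, with $D:=\mathcal{G}^{(0)}\setminus U$, and every nonempty subset $V\subseteq D$ that is compact and open in the relative topology of $D$, $1_V$ is an infinite idempotent in $A_K(\mathcal{G}_D)$. (4) Every nonzero one-sided ideal in any quotient ring of $A_K(\mathcal{G})$ contains an infinite idempotent (of that quotient). In particular, if one (hence all) of these statements holds, then $A_K(\mathcal{G})$ is also purely infinite.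
   Context: Groupoids. For a groupoid $\mathcal{G}$ write $s(\alpha)=\alpha^{-1}\alpha$, $r(\alpha)=\alpha\alpha^{-1}$, so that $\alpha\beta$ is defined iff $s(\alpha)=r(\beta)$; $\mathcal{G}^{(0)}=\{\alpha^{-1}\alpha:\alpha\in\mathcal{G}\}$ is the unit space and $\mathrm{Iso}(\mathcal{G})=\{\alpha: s(\alpha)=r(\alpha)\}$. A topological groupoid is a groupoid with a topology making composition and inversion continuous. An open subset $B\subseteq\mathcal{G}$ is a bisection if $r|_B$ and $s|_B$ are homeomorphisms onto open subsets of $\mathcal{G}^{(0)}$. $\mathcal{G}$ is ample if it has a basis of compact open bisections. A subset $U\subseteq\mathcal{G}^{(0)}$ is invariant if $s(\alpha)\in U$ implies $r(\alpha)\in U$; then $\mathcal{G}_U:=s^{-1}(U)$ is a subgroupoid with unit space $U$ (given the relative topology). $\mathcal{G}$ is effective if the interior of $\mathrm{Iso}(\mathcal{G})$ is $\mathcal{G}^{(0)}$; it is strongly effective if $\mathcal{G}_V$ is effective for every nonempty closed invariant $V\subseteq\mathcal{G}^{(0)}$. Steinberg algebra. For an ample Hausdorff groupoid $\mathcal{G}$ and a field $K$, $A_K(\mathcal{G})$ is the $K$-algebra of locally constant, compactly supported functions $\mathcal{G}\to K$ with pointwise addition and convolution $(fg)(\alpha)=\sum_{r(\beta)=r(\alpha)}f(\beta)g(\beta^{-1}\alpha)$. $1_B$ denotes the characteristic function of $B$. 'Ideal' without qualification means two-sided ideal. Infiniteness in rings. Rings are associative, not necessarily unital. For a ring $R$,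 $a\in M_m(R)$, $b\in M_n(R)$: $a\oplus b$ is the block diagonal matrix $\mathrm{diag}(a,b)$, and $a\precsim b$ means $a=xby$ for some $x\in M_{m,n}(R)$, $y\in M_{n,m}(R)$. A nonzero $a\in R$ is infinite if $a\oplus x\precsim a$ for some nonzero $x\in R$, and properly infinite if $a\oplus a\precsim a$. $R$ is purely infinite if (i) no quotient of $R$ is a division ring and (ii) for all $a\in R$, $b\in RaR$ implies $b\precsim a$, where $RaR$ is the set of finite sums of elements $ras'$ with $r,s'\in R$. $R$ is properly purely infinite if every nonzero element of $R$ is properly infinite. *)

(* Defs.v *)
From HB Require Import structures.
From mathcomp Require Import all_boot all_algebra ring_quotient.
From mathcomp Require Import all_classical topology.

Set Implicit Arguments.
Unset Strict Implicit.
Unset Printing Implicit Defensive.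

Import GRing.Theory.
Local Open Scope classical_set_scope.
Local Open Scope ring_scope.

(* The ring structures of MathComp are unital, hence this one. *)
HB.mixin Record Zmodule_isRng R of GRing.Zmodule R := {
  rmul : R -> R -> R;
  rmulA : associative rmul;
  rmulDl : left_distributive rmul +%R;
  rmulDr : right_distributive rmul +%R
}.

#[short(type="rngType")]
HB.structure Definition Rng := {R of Zmodule_isRng R & GRing.Zmodule R}.

Notation "x ** y" := (rmul x y) (at level 40, left associativity) : ring_scope.

Section RngTheory.
Variable R : rngType.
Implicit Types a b x y : R.

Lemma rmul0l x : 0 ** x = 0.
Proof. by apply: (addIr (0 ** x)); rewrite -rmulDl !add0r. Qed.

Lemma rmul0r x : x ** 0 = 0.
Proof. by apply: (addIr (x ** 0)); rewrite -rmulDr !add0r. Qed.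

Lemma rmulNl x y : (- x) ** y = - (x ** y).
Proof. by apply: (addIr (x ** y)); rewrite -rmulDl !addNr rmul0l. Qed.

Lemma rmulNr x y : x ** (- y) = - (x ** y).
Proof. by apply: (addIr (x ** y)); rewrite -rmulDr !addNr rmul0r. Qed.

Lemma rmulBl x y z : (x - y) ** z = x ** z - y ** z.
Proof. by rewrite rmulDl rmulNl. Qed.

Lemma rmulBr x y z : z ** (x - y) = z ** x - z ** y.
Proof. by rewrite rmulDr rmulNr. Qed.

(* [mulmx] requires a unital ring of coefficients. *)
Definition rmulmx m n p (A : 'M[R]_(m, n)) (B : 'M[R]_(n, p)) : 'M[R]_(m, p) :=
  \matrix_(i, k) \sum_j A i j ** B j k.

Definition mx1 a : 'M[R]_1 := const_mx a.

Definition dsum m n (a : 'M[R]_m) (b : 'M[R]_n) : 'M[R]_(m + n) :=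
  block_mx a 0 0 b.

Definition precsim m n (a : 'M[R]_m) (b : 'M[R]_n) : Prop :=
  exists (x : 'M[R]_(m, n)) (y : 'M[R]_(n, m)), a = rmulmx (rmulmx x b) y.

Definition infinite_elt a : Prop :=
  a != 0 /\ exists2 x, x != 0 & precsim (dsum (mx1 a) (mx1 x)) (mx1 a).

Definition properly_infinite_elt a : Prop :=
  a != 0 /\ precsim (dsum (mx1 a) (mx1 a)) (mx1 a).

Definition idempotent_elt a : Prop := a ** a = a.

Definition additive_subgroup (I : set R) : Prop :=
  I 0 /\ forall x y, I x -> I y -> I (x - y).

Definition left_ideal (I : set R) : Prop :=
  additive_subgroup I /\ forall r x, I x -> I (r ** x).

Definition right_ideal (I : set R) : Prop :=
  additive_subgroup I /\ forall r x, I x -> I (x ** r).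

Record ideal := Ideal {
  ideal_set :> set R;
  ideal_left : left_ideal ideal_set;
  ideal_right : right_ideal ideal_set
}.

(* The set usually written RaR. *)
Definition sandwich a : set R :=
  [set b | exists n (r s : 'I_n -> R), b = \sum_i r i ** a ** s i].

Definition division_ring : Prop :=
  exists e : R, [/\ e != 0,
    (forall x, e ** x = x /\ x ** e = x) &
    (forall x, x != 0 -> exists y, x ** y = e /\ y ** x = e)].

Definition properly_purely_infinite : Prop :=
  forall a, a != 0 -> properly_infinite_elt a.

End RngTheory.

Section RngQuotient.
Variables (R : rngType) (I : ideal R).

Definition ideal_pred : {pred R} := fun x => `[< ideal_set I x >].

Lemma ideal_zmod_closed : zmod_closed ideal_pred.
Proof.
have [[I0 IB] _] := ideal_left I; split; first exact/asboolP.
by move=> x y /asboolP Ix /asboolP Iy; apply/asboolP/IB.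
Qed.

HB.instance Definition _ :=
  GRing.isZmodClosed.Build R ideal_pred ideal_zmod_closed.

Definition rng_quotient := Quotient.quot ideal_pred.

HB.instance Definition _ := GRing.Zmodule.on rng_quotient.

Local Open Scope quotient_scope.

Local Notation pi := (\pi_(Quotient.quot ideal_pred) : R -> rng_quotient).

Definition rng_pi (x : R) : rng_quotient := pi x.

Lemma rng_pi_eq x y : rng_pi x = rng_pi y <-> ideal_set I (x - y).
Proof.
split=> [/eqP|Ixy]; last apply/eqP.
  by rewrite /rng_pi -Quotient.idealrBE => /asboolP.
by rewrite /rng_pi -Quotient.idealrBE; apply/asboolP.
Qed.

Lemma rng_piK q : rng_pi (repr (q : Quotient.quot ideal_pred)) = q.
Proof. exact: reprK. Qed.

Lemma rng_piD x y : rng_pi (x + y) = rng_pi x + rng_pi y.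
Proof. by rewrite /rng_pi raddfD. Qed.

Definition quot_mul (p q : rng_quotient) : rng_quotient :=
  rng_pi (repr (p : Quotient.quot ideal_pred) **
          repr (q : Quotient.quot ideal_pred)).

Lemma rng_piM x y : quot_mul (rng_pi x) (rng_pi y) = rng_pi (x ** y).
Proof.
apply/rng_pi_eq; set x' := repr _; set y' := repr _.
have [[I0 IB] Il] := ideal_left I; have [_ Ir] := ideal_right I.
have xx' : ideal_set I (x' - x) by apply/rng_pi_eq; exact: rng_piK.
have yy' : ideal_set I (y' - y) by apply/rng_pi_eq; exact: rng_piK.
have -> : x' ** y' - x ** y = (x' - x) ** y' - x ** (y - y').
  by rewrite rmulBl rmulBr opprB addrA subrK.
apply: (IB); first exact: Ir.
have -> : x ** (y - y') = 0 - x ** (y' - y) by rewrite sub0r -rmulNr opprB.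
by apply: (IB) => //; exact: Il.
Qed.

Lemma quot_mulA : associative quot_mul.
Proof.
by move=> x y z; rewrite -[x]rng_piK -[y]rng_piK -[z]rng_piK !rng_piM rmulA.
Qed.

Lemma quot_mulDl : left_distributive quot_mul +%R.
Proof.
move=> x y z; rewrite -[x]rng_piK -[y]rng_piK -[z]rng_piK.
by rewrite -rng_piD !rng_piM rmulDl rng_piD.
Qed.

Lemma quot_mulDr : right_distributive quot_mul +%R.
Proof.
move=> x y z; rewrite -[x]rng_piK -[y]rng_piK -[z]rng_piK.
by rewrite -rng_piD !rng_piM rmulDr rng_piD.
Qed.

HB.instance Definition _ := Zmodule_isRng.Build rng_quotient
  quot_mulA quot_mulDl quot_mulDr.

End RngQuotient.

Definition purely_infinite (R : rngType) : Prop :=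
  (forall I : ideal R, ~ division_ring (rng_quotient I)) /\
  (forall a b : R, sandwich a b -> precsim (mx1 b) (mx1 a)).

(* [mul a b] is only meaningful when [a] and [b] are composable, i.e. when
   s(a) = r(b); outside of composable pairs it is unconstrained. *)
Definition composable_for T (mul : T -> T -> T) (inv : T -> T) a b : Prop :=
  mul (inv a) a = mul b (inv b).

HB.mixin Record isGroupoid T := {
  gmul : T -> T -> T;
  ginv : T -> T;
  ginvK : involutive ginv;
  gmulA_subproof : forall a b c,
    composable_for gmul ginv a b -> composable_for gmul ginv b c ->
    [/\ composable_for gmul ginv (gmul a b) c,
        composable_for gmul ginv a (gmul b c) &
        gmul (gmul a b) c = gmul a (gmul b c)];
  gmulK_subproof : forall a b, composable_for gmul ginv a b ->
    gmul (ginv a) (gmul a b) = b /\ gmul (gmul a b) (ginv b) = a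
}.

#[short(type="groupoidType")]
HB.structure Definition Groupoid := {T of isGroupoid T}.

Section GroupoidTheory.
Variable G : groupoidType.
Implicit Types a b c : G.

Definition gsrc a : G := gmul (ginv a) a.
Definition gran a : G := gmul a (ginv a).
Definition units : set G := range gsrc.
Definition isotropy : set G := [set a | gsrc a = gran a].

Lemma gmulA a b c : gsrc a = gran b -> gsrc b = gran c ->
  gmul (gmul a b) c = gmul a (gmul b c).
Proof. by move=> ab bc; have [] := gmulA_subproof _ _ _ ab bc. Qed.

Lemma gmulKl a b : gsrc a = gran b -> gmul (ginv a) (gmul a b) = b.
Proof. by case/gmulK_subproof. Qed.

Lemma gmulKr a b : gsrc a = gran b -> gmul (gmul a b) (ginv b) = a.
Proof. by case/gmulK_subproof. Qed.

Lemma gsrcV a : gsrc (ginv a) = gran a.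
Proof. by rewrite /gsrc ginvK. Qed.

Lemma granV a : gran (ginv a) = gsrc a.
Proof. by rewrite /gran ginvK. Qed.

Lemma gsrcM a b : gsrc a = gran b -> gsrc (gmul a b) = gsrc b.
Proof.
move=> ab; have bV : gsrc b = gran (ginv b) by rewrite granV.
have [e _ _] := gmulA_subproof _ _ _ ab bV.
exact: etrans e (granV b).
Qed.

Lemma granM a b : gsrc a = gran b -> gran (gmul a b) = gran a.
Proof.
move=> ab; have Va : gsrc (ginv a) = gran a by rewrite gsrcV.
have [_ e _] := gmulA_subproof _ _ _ Va ab.
exact: etrans (esym e) (gsrcV a).
Qed.

Lemma gsrc_src a : gsrc (gsrc a) = gsrc a.
Proof. by rewrite {2}/gsrc gsrcM// gsrcV. Qed.

Lemma gran_src a : gran (gsrc a) = gsrc a.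
Proof. by rewrite {1}/gsrc granM ?gsrcV// granV. Qed.

Lemma gsrc_ran a : gsrc (gran a) = gran a.
Proof. by rewrite -gsrcV gsrc_src. Qed.

Lemma gran_ran a : gran (gran a) = gran a.
Proof. by rewrite -[gran a]gsrcV gran_src. Qed.

Lemma gmul_src a : gmul a (gsrc a) = a.
Proof. by rewrite -{1}[a]ginvK /gsrc gmulKl// gsrcV. Qed.

Lemma gmul_ran a : gmul (gran a) a = a.
Proof. by rewrite -{2}[a]ginvK /gran gmulKr// granV. Qed.

Lemma gmulVK a c : gran a = gran c -> gmul a (gmul (ginv a) c) = c.
Proof. by move=> ac; rewrite -{1}[a]ginvK gmulKl// gsrcV. Qed.

Lemma units_src a : units (gsrc a). Proof. by exists a. Qed.

Lemma units_ran a : units (gran a).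
Proof. by rewrite -gsrcV; exact: units_src. Qed.

Lemma units_gsrc a : units a -> gsrc a = a.
Proof. by case=> b _ <-; rewrite gsrc_src. Qed.

Lemma units_gran a : units a -> gran a = a.
Proof. by case=> b _ <-; rewrite gran_src. Qed.

Definition unit_space := set_type units.

Definition src a : unit_space := exist _ (gsrc a) (mem_set (units_src a)).
Definition ran a : unit_space := exist _ (gran a) (mem_set (units_ran a)).

Definition invariant (U : set unit_space) : Prop :=
  forall a, U (src a) -> U (ran a).

End GroupoidTheory.

HB.mixin Record isTopologicalGroupoid T of Topological T & Groupoid T := {
  gmul_continuous : {within [set p : T * T | gsrc p.1 = gran p.2],
    continuous (fun p : T * T => gmul p.1 p.2)};
  ginv_continuous : continuous (ginv : T -> T)
}.

#[short(type="topGroupoidType")]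
HB.structure Definition TopologicalGroupoid :=
  {T of isTopologicalGroupoid T & Topological T & Groupoid T}.

HB.instance Definition _ (G : topGroupoidType) := Topological.on (unit_space G).

Section TopologicalGroupoidDefs.
Variable G : topGroupoidType.

Definition homeomorphic_onto_open (B : set G) (f : G -> unit_space G) : Prop :=
  exists g : unit_space G -> G,
    [/\ {within B, continuous f}, {within f @` B, continuous g},
        (forall a, B a -> g (f a) = a) & open (f @` B)].

Definition bisection (B : set G) : Prop :=
  [/\ open B, homeomorphic_onto_open B (@ran G) &
      homeomorphic_onto_open B (@src G)].

Definition ample : Prop := exists2 Bs : set (set G), basis Bs &
  forall B, Bs B -> compact B /\ bisection B.

Definition effective : Prop := interior (@isotropy G) = @units G.

End TopologicalGroupoidDefs.

HB.mixin Record isAmpleHausdorff T of TopologicalGroupoid T := {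
  ample_subproof : ample T;
  hausdorff_subproof : hausdorff_space T
}.

#[short(type="ampleHausdorffGroupoidType")]
HB.structure Definition AmpleHausdorffGroupoid :=
  {T of isAmpleHausdorff T & TopologicalGroupoid T}.

Section LocallyConstant.
Variables (T : topologicalType) (K : zmodType).
Implicit Types f g : T -> K.

Definition locally_constant f : Prop :=
  forall x, \forall y \near x, f y = f x.

Definition compactly_supported f : Prop := compact (closure [set x | f x != 0]).

Lemma locally_constant_open f (A : set K) :
  locally_constant f -> open (f @^-1` A).
Proof.
move=> lcf; rewrite openE => x Ax; rewrite /interior.
by apply: filterS (lcf x) => y /= ->.
Qed.

Lemma locally_constant_closed f (A : set K) :
  locally_constant f -> closed (f @^-1` A).
Proof.
by move=> lcf; rewrite -openC; exact: (@locally_constant_open f (~` A)).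
Qed.

Lemma locally_constant_supp f : locally_constant f ->
  closure [set x | f x != 0] = [set x | f x != 0].
Proof.
move=> lcf; apply/esym/closure_id.
rewrite (_ : mkset _ = f @^-1` [set~ 0]); first exact: locally_constant_closed.
by apply/seteqP; split=> x /eqP.
Qed.

End LocallyConstant.

Section Steinberg.
Variables (K : fieldType) (G : topGroupoidType).

Definition steinberg_pred : {pred G -> K} :=
  fun f => `[< locally_constant f /\ compactly_supported f >].

Record steinberg := Steinberg {
  steinberg_fun :> G -> K;
  steinbergP : steinberg_fun \in steinberg_pred
}.

HB.instance Definition _ := [isSub for steinberg_fun].
HB.instance Definition _ := [Choice of steinberg by <:].

Lemma steinberg_predP (f : G -> K) : f \in steinberg_pred <->
  locally_constant f /\ compact [set x | f x != 0].
Proof.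
split=> [/asboolP[lcf]|[lcf cf]]; last first.
  by apply/asboolP; split => //; rewrite /compactly_supported locally_constant_supp.
by rewrite /compactly_supported locally_constant_supp.
Qed.

Lemma steinberg_zmod_closed : zmod_closed steinberg_pred.
Proof.
split=> [|f g /steinberg_predP[lf cf] /steinberg_predP[lg cg]].
  apply/steinberg_predP; split; first by move=> x; apply: filterE.
  rewrite [X in compact X](_ : _ = set0); first exact: compact0.
  by apply/seteqP; split=> x //=; rewrite eqxx.
have lfg : locally_constant (f - g).
  move=> x; apply: filterS2 (lf x) (lg x) => y fy gy.
  by rewrite !fctE fy gy.
apply/steinberg_predP; split=> //.
apply: subclosed_compact (compactU cf cg) _.
  by rewrite -locally_constant_supp//; exact: closed_closure.
move=> x /=; rewrite !fctE; case: (eqVneq (f x) 0) => [->|]; last by left.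
by case: (eqVneq (g x) 0) => [->|]; [rewrite subrr eqxx | right].
Qed.

HB.instance Definition _ :=
  GRing.isZmodClosed.Build (G -> K) steinberg_pred steinberg_zmod_closed.
HB.instance Definition _ := [SubChoice_isSubZmodule of steinberg by <:].

(* [\sum_(b \in _)] is 0 when infinitely many terms are nonzero. This does not
   happen for [f] of compact support on an ample Hausdorff groupoid, see
   [steinberg_fiber]. *)
Definition convolution (f g : G -> K) (a : G) : K :=
  \sum_(b \in [set b | gran b = gran a]) f b * g (gmul (ginv b) a).

End Steinberg.

Section ContinuityLemmas.

Lemma within_continuous_comp_near (S T U : topologicalType) (A : set T)
    (p : S -> T) (f : T -> U) x :
  {within A, continuous f} -> {for x, continuous p} ->
  (\forall y \near x, A (p y)) -> {for x, continuous (f \o p)}.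
Proof.
move=> /subspace_continuousP cf cp Ap.
have Apx : A (p x) by exact: nbhs_singleton Ap.
move=> W /(cf _ Apx) /cp/= Wp.
by apply: (filterS2 _ _ Ap Wp) => y Ay; exact.
Qed.

Lemma set_type_continuous (S T : topologicalType) (A : set T)
    (f : S -> set_type A) x :
  {for x, continuous (\val \o f)} -> {for x, continuous f}.
Proof.
move=> cf W [_ [[V oV <-] /= Vfx VW]].
have nV : nbhs (\val (f x)) V by exact: open_nbhs_nbhs.
have : \forall y \near x, V (\val (f y)) := cf V nV.
by apply: filterS => y /VW.
Qed.

Lemma val_continuous (T : topologicalType) (A : set T) :
  continuous (\val : set_type A -> T).
Proof. exact: initial_continuous. Qed.

Lemma set_type_hausdorff (T : topologicalType) (A : set T) :
  hausdorff_space T -> hausdorff_space (set_type A).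
Proof.
move=> hT x y cxy; apply/val_inj/hT => U V /val_continuous Ux /val_continuous Vy.
by have [z [Uz Vz]] := cxy _ _ Ux Vy; exists (\val z).
Qed.

Lemma compact_set_type (T : topologicalType) (A : set T) (B : set (set_type A)) :
  compact (\val @` B) <-> compact B.
Proof.
split=> cB; last first.
  by apply: continuous_compact => //; apply: continuous_subspaceT => x;
     exact: val_continuous.
move=> F PF FB.
have FB' : (\val @ F) (\val @` B).
  by rewrite /= nbhs_simpl; apply: filterS FB => b Bb; exists b.
have [x [[b Bb <-] Fb]] := cB (\val @ F) _ FB'.
exists b; split=> // U V FU [_ [[W oW <-] Wb WV]].
have : (\val @ F) (\val @` U).
  by rewrite /= nbhs_simpl; apply: filterS FU => u Uu; exists u.
move=> /Fb /(_ (open_nbhs_nbhs (conj oW Wb)))[_ [[u Uu <-] Wu]].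
by exists u; split=> //; exact: WV.
Qed.

Lemma closed_eq_fun (T U : topologicalType) (f g : T -> U) :
  hausdorff_space U -> continuous f -> continuous g ->
  closed [set x | f x = g x].
Proof.
rewrite open_hausdorff => hU cf cg; rewrite -openC openE => x /= /eqP fg.
have [[A B]/= [/set_mem Af /set_mem Bg] [oA oB /eqP AB]] := hU _ _ fg.
have nA : \forall y \near x, A (f y) := cf x A (open_nbhs_nbhs (conj oA Af)).
have nB : \forall y \near x, B (g y) := cg x B (open_nbhs_nbhs (conj oB Bg)).
apply: (filterS2 _ _ nA nB) => y Ay By /= e; suff : set0 (f y) by [].
by rewrite -AB; split=> //; rewrite e.
Qed.

End ContinuityLemmas.

Section TopologicalGroupoidTheory.
Variable G : topGroupoidType.

Lemma gmul_continuous_comp (S : topologicalType) (p q : S -> G) x :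
  {for x, continuous p} -> {for x, continuous q} ->
  (\forall y \near x, gsrc (p y) = gran (q y)) ->
  {for x, continuous (fun y => gmul (p y) (q y))}.
Proof.
move=> cp cq pq.
apply: (@within_continuous_comp_near _ _ _ _ (fun y => (p y, q y)) _ _
  (@gmul_continuous G)) => //.
exact: cvg_pair.
Qed.

Lemma gsrc_continuous : continuous (@gsrc G).
Proof.
move=> x; apply: gmul_continuous_comp; first exact: ginv_continuous.
  exact: cvg_id.
by apply: nearW => y; rewrite gsrcV.
Qed.

Lemma gran_continuous : continuous (@gran G).
Proof.
move=> x; apply: gmul_continuous_comp; first exact: cvg_id.
  exact: ginv_continuous.
by apply: nearW => y; rewrite granV.
Qed.

Lemma src_continuous : continuous (@src G).
Proof. by move=> x; apply: set_type_continuous; exact: gsrc_continuous. Qed.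

Lemma ran_continuous : continuous (@ran G).
Proof. by move=> x; apply: set_type_continuous; exact: gran_continuous. Qed.

Lemma ran_eq (a b : G) : ran a = ran b <-> gran a = gran b.
Proof.
by split=> [/(congr1 val)//|e]; apply/val_inj.
Qed.

Lemma src_eq (a b : G) : src a = src b <-> gsrc a = gsrc b.
Proof.
by split=> [/(congr1 val)//|e]; apply/val_inj.
Qed.

End TopologicalGroupoidTheory.

Section AmpleTheory.
Variable G : ampleHausdorffGroupoidType.
Implicit Types (a b c : G) (B C : set G).

Lemma bisection_at a : exists B, [/\ compact B, bisection B & B a].
Proof.
have [Bs [_ Bsb] cBs] := @ample_subproof G.
have [B [BsB Ba] _] := Bsb a setT filterT.
by exists B; have [] := cBs B BsB.
Qed.

Lemma compact_bisection_cover C : compact C -> exists2 s : seq (set G),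
  (forall B, B \in s -> compact B /\ bisection B) &
  C `<=` [set a | exists2 B, B \in s & B a].
Proof.
move=> /compact_near_coveringP cC.
pose good (s : seq (set G)) := forall B, B \in s -> compact B /\ bisection B.
pose F := filter_from good (fun s => [set t | good t /\ {subset s <= t}]).
have FF : Filter F.
  apply: filter_from_filter; first by exists [::].
  move=> s t gs gt; exists (s ++ t).
    by move=> B; rewrite mem_cat => /orP[/gs|/gt].
  move=> u [gu stu]; split; split=> // B Bs; apply: stu.
    by rewrite mem_cat Bs.
  by rewrite mem_cat Bs orbT.
have [|s gs sC] := cC _ F (fun s a => exists2 B, B \in s & B a) FF.
  move=> a Ca; have [B [cB bB Ba]] := bisection_at a.
  exists (B, [set t | good t /\ {subset [:: B] <= t}]).
    split=> /=; first by apply: open_nbhs_nbhs; split=> //; case: bB.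
    by exists [:: B] => // B'; rewrite inE => /eqP ->.
  by move=> [b t] /= [Bb [gt Bt]]; exists B => //; apply: Bt; rewrite inE.
by exists s => // a; exact: (sC s (conj gs (fun _ h => h))) a.
Qed.

Lemma bisection_ran_inj B a b : bisection B -> B a -> B b ->
  gran a = gran b -> a = b.
Proof.
move=> [_ [g [_ _ gK _]] _] Ba Bb /ran_eq ab.
by rewrite -(gK _ Ba) ab gK.
Qed.

Lemma fiber_finite C a :
  compact C -> finite_set ([set b | gran b = a] `&` C).
Proof.
move=> /compact_bisection_cover[s sB Cs].
apply: (@sub_finite_set _ _ (\bigcup_(B in [set` s])
  ([set b | gran b = a] `&` B))).
  by move=> b [ba /Cs[B Bsn Bb]]; exists B.
apply: bigcup_finite; first exact: finite_seq.
move=> B /= Bsn; have [_ bB] := sB B Bsn.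
have [[b [ba Bb]]|N] := pselect (exists b, gran b = a /\ B b); last first.
  by apply: sub_finite_set (@finite_set0 G) => b Bb; case: N; exists b.
apply: sub_finite_set (finite_set1 b) => c [/= ca Bc].
by apply: bisection_ran_inj Bc Bb _; rewrite // ca ba.
Qed.

Lemma unit_space_hausdorff : hausdorff_space (unit_space G).
Proof. exact/set_type_hausdorff/hausdorff_subproof. Qed.

Lemma units_open : open (@units G).
Proof.
rewrite openE => a ua; rewrite /interior.
have [B [_ bB Ba]] := bisection_at a; have [oB _ _] := bB.
have nB : \forall b \near a, B b by exact: open_nbhs_nbhs.
have nBr : \forall b \near a, B (gran b).
  apply: (@gran_continuous G); rewrite units_gran//; exact: open_nbhs_nbhs.
apply: (filterS2 _ _ nB nBr) => b Bb Brb.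
have -> : b = gran b; last exact: units_ran.
by apply: bisection_ran_inj bB Bb Brb _; rewrite gran_ran.
Qed.

End AmpleTheory.

Section Convolution.
Variables (K : fieldType) (G : ampleHausdorffGroupoidType).
Implicit Types (a b c : G) (f g h : G -> K).
Local Notation S := (@steinberg_pred K G).

Lemma steinberg_fiber f a : f \in S ->
  finite_set ([set b | gran b = a] `&` [set b | f b != 0]).
Proof. by move=> /steinberg_predP[_]; exact: fiber_finite. Qed.

Lemma convolutionE f g a (F : set G) : F `<=` [set b | gran b = gran a] ->
  (forall b, gran b = gran a -> f b != 0 -> F b) ->
  convolution f g a = \sum_(b \in F) f b * g (gmul (ginv b) a).
Proof.
move=> sF fF; apply/esym/fsbig_widen => // b [/= ba nFb].
by case: (eqVneq (f b) 0) => [->|/(fF _ ba)//]; rewrite mul0r.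
Qed.

Lemma convolutionDl f f' g : f \in S -> f' \in S ->
  convolution (f + f') g = convolution f g + convolution f' g.
Proof.
move=> Sf Sf'; apply/funext => a; rewrite !fctE.
pose F := [set b | gran b = gran a] `&` ([set b | f b != 0] `|` [set b | f' b != 0]).
have fF : finite_set F.
  by rewrite /F setIUr finite_setU; split; exact: steinberg_fiber.
have FE f0 : (forall b, f0 b != 0 -> f b != 0 \/ f' b != 0) ->
    convolution f0 g a = \sum_(b \in F) f0 b * g (gmul (ginv b) a).
  by move=> H; apply: convolutionE => [b []//|b ba /H Hb]; split.
have -> : convolution f g a = \sum_(b \in F) f b * g (gmul (ginv b) a).
  by apply: FE; left.
have -> : convolution f' g a = \sum_(b \in F) f' b * g (gmul (ginv b) a).
  by apply: FE; right.
rewrite FE => [|b].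
  by rewrite -fsbig_split//=; apply: eq_fsbigr => b _; rewrite mulrDl.
case: (eqVneq (f b) 0) => [->|]; last by left.
by rewrite add0r; right.
Qed.

Lemma convolutionDr f g g' : f \in S ->
  convolution f (g + g') = convolution f g + convolution f g'.
Proof.
move=> Sf; apply/funext => a; rewrite !fctE.
have fF := steinberg_fiber (gran a) Sf.
rewrite !(@convolutionE _ _ a ([set b | gran b = gran a] `&` [set b | f b != 0]));
  try by [move=> b []|move=> b ba fb; split].
by rewrite -fsbig_split//=; apply: eq_fsbigr => b _; rewrite mulrDr.
Qed.

(* The case of a function supported on a bisection: there the fibre over
   r(a) is met at [k (ran a)] only, with [k] a continuous section of [ran]. *)
Lemma convolution_bisection B f g : bisection B -> f \in S -> g \in S ->
  [set b | f b != 0] `<=` B -> locally_constant (convolution f g).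
Proof.
move=> bB Sf /steinberg_predP[lg _] fB a.
have [lf cf] := (steinberg_predP _).1 Sf.
have [oB [k [_ ck kK oU]] _] := bB.
have [[b [fb ba]]|nfa] := pselect (exists b, f b != 0 /\ gran b = gran a).
  have convk c : (@ran G @` B) (ran c) ->
      convolution f g c = f (k (ran c)) * g (gmul (ginv (k (ran c))) c).
    move=> [d Bd /[dup] e /ran_eq dc]; rewrite -e kK//.
    rewrite (@convolutionE _ _ _ [set d]) ?fsbig_set1//; first by move=> _ ->.
    move=> d' d'c fd'; apply: (bisection_ran_inj bB) => //; first exact: fB.
    by rewrite dc.
  have nU : \forall c \near a, (@ran G @` B) (ran c).
    apply: (@ran_continuous G); apply: open_nbhs_nbhs; split=> //.
    by exists b; [exact: fB|apply/ran_eq].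
  have ck' : {for a, continuous (fun c => k (ran c))}.
    exact: within_continuous_comp_near ck (@ran_continuous G a) nU.
  have kr : \forall c \near a, gran (k (ran c)) = gran c.
    apply: filterS nU => c [d Bd /[dup] e /ran_eq dc].
    by rewrite -e kK.
  have nf : \forall c \near a, f (k (ran c)) = f (k (ran a)) := ck' _ (lf _).
  have cm : {for a, continuous (fun c => gmul (ginv (k (ran c))) c)}.
    apply: gmul_continuous_comp; last by apply: filterS kr => c; rewrite gsrcV.
      by apply: continuous_comp => //; exact: ginv_continuous.
    exact: cvg_id.
  have ng : \forall c \near a, g (gmul (ginv (k (ran c))) c) =
      g (gmul (ginv (k (ran a))) a) := cm _ (lg _).
  apply: (filterS3 _ _ nU nf ng) => c Uc fc gc.
  by rewrite !convk// ?fc ?gc//; exact: nbhs_singleton nU.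
have conv0 c : (~ (@ran G @` [set b | f b != 0]) (ran c)) ->
    convolution f g c = 0.
  move=> nc; apply: fsbig1 => b /= bc.
  case: (eqVneq (f b) 0) => [->|fb]; first by rewrite mul0r.
  by case: nc; exists b => //; apply/ran_eq.
have nra : ~ (@ran G @` [set b | f b != 0]) (ran a).
  by move=> [b fb /ran_eq ba]; apply: nfa; exists b.
have cl : closed (@ran G @` [set b | f b != 0]).
  apply: compact_closed; first exact: unit_space_hausdorff.
  apply: continuous_compact => //; apply: continuous_subspaceT.
  exact: ran_continuous.
have nC : \forall c \near a, (~` (@ran G @` [set b | f b != 0])) (ran c).
  apply: (@ran_continuous G); apply: open_nbhs_nbhs; split=> //.
  by rewrite openC.
by apply: filterS nC => c /conv0 ->; rewrite conv0.
Qed.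

Lemma steinberg_restrict B f : compact B -> open B -> f \in S ->
  (fun a => if a \in B then f a else 0) \in S.
Proof.
move=> cB oB /steinberg_predP[lf cf].
have clB : closed B by apply: compact_closed => //; exact: hausdorff_subproof.
have lc : locally_constant (fun a => if a \in B then f a else 0).
  move=> a; case: ifPn => [/set_mem Ba|/negP aB].
    have nB : nbhs a B by exact: open_nbhs_nbhs.
    by apply: (filterS2 _ _ nB (lf a)) => b /mem_set ->.
  have nB : nbhs a (~` B).
    apply: open_nbhs_nbhs; split; first by rewrite openC.
    by move=> /mem_set.
  by apply: filterS nB => b nBb; case: ifPn => // /set_mem.
apply/steinberg_predP; split=> //.
apply: subclosed_compact cf _; first by rewrite -locally_constant_supp//; exact: closed_closure.
by move=> a /=; case: ifP => //; rewrite eqxx.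
Qed.

Lemma convolution_locally_constant f g : f \in S -> g \in S ->
  locally_constant (convolution f g).
Proof.
move=> Sf Sg; have [_ cf] := (steinberg_predP _).1 Sf.
have [s sB] := compact_bisection_cover cf.
elim: s f Sf sB {cf} => [|B s IH] f Sf sB fs.
  have -> : convolution f g = 0; last by move=> a; apply: filterE.
  apply/funext => a; apply: fsbig1 => b _.
  case: (eqVneq (f b) 0) => [->|fb]; first by rewrite mul0r.
  by have [] := fs b fb.
have [cB bB] := sB B (mem_head _ _); have [oB _ _] := bB.
pose f1 := fun a => if a \in B then f a else 0.
have Sf1 : f1 \in S by exact: steinberg_restrict.
have Sf2 : f - f1 \in S by rewrite rpredB.
have -> : f = f1 + (f - f1) by rewrite addrC subrK.
rewrite convolutionDl//.
have l1 : locally_constant (convolution f1 g).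
  apply: convolution_bisection bB Sf1 Sg _ => a /=.
  by rewrite /f1; case: ifPn => [/set_mem//|]; rewrite eqxx.
have l2 : locally_constant (convolution (f - f1) g).
  apply: IH => // [C Cs|a]; first by apply: sB; rewrite inE Cs orbT.
  rewrite /= !fctE /f1; case: ifPn => [_|aB]; first by rewrite subrr eqxx.
  rewrite subr0 => /fs[C]; rewrite inE => /orP[/eqP ->|Cs Ca]; last by exists C.
  by move/mem_set; rewrite (negPf aB).
move=> a; apply: (filterS2 _ _ (l1 a) (l2 a)) => b; rewrite !fctE.
by move=> -> ->.
Qed.

Lemma convolution_neq0 f g a : convolution f g a != 0 ->
  exists b, [/\ gran b = gran a, f b != 0 & g (gmul (ginv b) a) != 0].
Proof.
move=> /(@fsbigN1 _ _ _ G G _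
  (fun a b => f b * g (gmul (ginv b) a)) a)[b /= ba]; rewrite mulf_eq0 negb_or => /andP[fb gb].
by exists b.
Qed.

Lemma convolution_steinberg f g : f \in S -> g \in S -> convolution f g \in S.
Proof.
move=> Sf Sg; have lc := convolution_locally_constant Sf Sg.
apply/steinberg_predP; split=> //.
have [_ cf] := (steinberg_predP _).1 Sf; have [_ cg] := (steinberg_predP _).1 Sg.
pose P := [set p : G * G | gsrc p.1 = gran p.2].
have clP : closed P.
  apply: closed_eq_fun; first exact: hausdorff_subproof.
    by move=> p; apply: continuous_comp; [exact: cvg_fst|exact: gsrc_continuous].
  by move=> p; apply: continuous_comp; [exact: cvg_snd|exact: gran_continuous].
have cP := compact_closedI (compact_setX cf cg) clP.
have cm : compact ((fun p : G * G => gmul p.1 p.2) @`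
    (([set a | f a != 0] `*` [set a | g a != 0]) `&` P)).
  apply: continuous_compact => //.
  apply: continuous_subspaceW (@gmul_continuous G).
  exact: subIsetr.
apply: subclosed_compact cm _.
  by rewrite -locally_constant_supp//; exact: closed_closure.
move=> a /= /convolution_neq0[b [ba fb gb]].
exists (b, gmul (ginv b) a); last by rewrite /= gmulVK.
by split=> //=; rewrite /P/= granM ?granV// gsrcV.
Qed.

Lemma convolutionA f g h : f \in S -> g \in S ->
  convolution f (convolution g h) = convolution (convolution f g) h.
Proof.
move=> Sf Sg; apply/funext => a.
pose C := [set c | gran c = gran a] `&` [set c | f c != 0].
have fC : finite_set C by exact: steinberg_fiber.
pose D c := [set d | gran d = gsrc c] `&` [set d | g d != 0].
have fD c : finite_set (D c) by exact: steinberg_fiber.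
pose B := \bigcup_(c in C) (gmul c @` D c).
have fB : finite_set B.
  by apply: bigcup_finite => // c _; exact: finite_image.
have Ba : B `<=` [set b | gran b = gran a].
  by move=> b [c [/= <- _] [d [/= dc _] <-]]; rewrite granM.
rewrite (@convolutionE _ _ _ C); [|by move=> c []|by move=> c ca fc; split].
rewrite (@convolutionE (convolution f g) _ _ B)//; last first.
  move=> b ba /convolution_neq0[c [cb fc gc]].
  exists c; first by split=> //=; rewrite cb.
  exists (gmul (ginv c) b); last by rewrite gmulVK.
  by split=> //=; rewrite granM ?gsrcV// granV.
transitivity (\sum_(c \in C) \sum_(b \in B)
    f c * (g (gmul (ginv c) b) * h (gmul (ginv b) a))).
  apply: eq_fsbigr => c /set_mem[/= ca fc].
  rewrite -mulr_fsumr; congr (_ * _).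
  have ca' : gsrc (ginv c) = gran a by rewrite gsrcV.
  have -> : \sum_(b \in B) g (gmul (ginv c) b) * h (gmul (ginv b) a) =
      \sum_(b \in [set b | gran b = gran a])
         g (gmul (ginv c) b) * h (gmul (ginv b) a).
    apply: fsbig_widen => // b [/= ba nBb].
    case: (eqVneq (g (gmul (ginv c) b)) 0) => [->|gb]; first by rewrite mul0r.
    case: nBb; exists c => //; exists (gmul (ginv c) b); last first.
      by rewrite gmulVK// ca.
    by split=> //=; rewrite granM ?granV// gsrcV ca.
  rewrite /convolution (@reindex_fsbig _ _ _ _ _ (gmul (ginv c))
    [set b | gran b = gran a]).
    apply: eq_fsbigr => b /set_mem /= ba; congr (_ * h _).
    have cb : gsrc (ginv c) = gran b by rewrite gsrcV ca.
    have e1 : gran (gmul (ginv c) b) = gsrc c by rewrite granM// granV.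
    have bx : gsrc b = gran (gmul (ginv b) a) by rewrite granM ?granV// gsrcV.
    rewrite -[RHS](@gmulKl _ (gmul (ginv c) b) (gmul (ginv b) a)) ?gsrcM//.
    by rewrite gmulA// gmulVK.
  split=> [b /= ba|b b' /set_mem/= ba /set_mem/= b'a e|d /= da].
  - by rewrite !granM// gsrcV ca.
  - by rewrite -[b](@gmulVK _ c) ?ca// e gmulVK// ca.
  have cd : gsrc c = gran d by rewrite da granM// granV.
  by exists (gmul c d) => /=; [rewrite granM|rewrite gmulKl].
rewrite exchange_fsbig//; apply: eq_fsbigr => b /set_mem Bb.
rewrite (@convolutionE _ _ _ C).
- by rewrite mulr_fsuml; apply: eq_fsbigr => c _; rewrite mulrA.
- by move=> c [/= -> _]; rewrite (Ba _ Bb).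
- by move=> c cb fc; split=> //=; rewrite cb; exact: Ba.
Qed.

Definition steinberg_mul (f g : steinberg K G) : steinberg K G :=
  Steinberg (convolution_steinberg (steinbergP f) (steinbergP g)).

Lemma steinberg_mulA : associative steinberg_mul.
Proof. by move=> f g h; apply/val_inj/convolutionA; exact: steinbergP. Qed.

Lemma steinberg_mulDl : left_distributive steinberg_mul +%R.
Proof. by move=> f g h; apply/val_inj/convolutionDl; exact: steinbergP. Qed.

Lemma steinberg_mulDr : right_distributive steinberg_mul +%R.
Proof. by move=> f g h; apply/val_inj/convolutionDr; exact: steinbergP. Qed.

HB.instance Definition _ := Zmodule_isRng.Build (steinberg K G)
  steinberg_mulA steinberg_mulDl steinberg_mulDr.

End Convolution.

Record closed_invariant (G : topGroupoidType) := ClosedInvariant {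
  ci_set :> set (unit_space G);
  ci_closed : closed ci_set;
  ci_invariant : invariant ci_set
}.

Record open_invariant (G : topGroupoidType) := OpenInvariant {
  oi_set :> set (unit_space G);
  oi_open : open oi_set;
  oi_invariant : invariant oi_set
}.

Section ReductionGroupoid.
Variables (G : topGroupoidType) (V : closed_invariant G).

Definition reduction := set_type (@src G @^-1` ci_set V).

HB.instance Definition _ := Topological.on reduction.

Implicit Types a b c : reduction.

Lemma reductionP a : ci_set V (src (\val a)).
Proof. exact: (@set_valP _ (@src G @^-1` ci_set V) a). Qed.

Lemma reduction_ran a : ci_set V (ran (\val a)).
Proof. exact/ci_invariant/reductionP. Qed.

(* [insubd] only serves to avoid carrying proofs: see [val_red_inv] and
   [val_red_mul]. *)
Definition red_inv a : reduction := insubd a (ginv (\val a)).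
Definition red_mul a b : reduction := insubd a (gmul (\val a) (\val b)).

Lemma val_red_inv a : \val (red_inv a) = ginv (\val a).
Proof.
rewrite insubdK//; apply/mem_set => /=.
by have -> : src (ginv (\val a)) = ran (\val a);
  [apply/val_inj; exact: gsrcV | exact: reduction_ran].
Qed.

Lemma val_red_mul a b : gsrc (\val a) = gran (\val b) ->
  \val (red_mul a b) = gmul (\val a) (\val b).
Proof.
move=> ab; rewrite insubdK//; apply/mem_set => /=.
by have -> : src (gmul (\val a) (\val b)) = src (\val b);
  [apply/val_inj; exact: gsrcM | exact: reductionP].
Qed.

Lemma val_red_src a : \val (red_mul (red_inv a) a) = gsrc (\val a).
Proof. by rewrite val_red_mul val_red_inv// gsrcV. Qed.

Lemma val_red_ran a : \val (red_mul a (red_inv a)) = gran (\val a).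
Proof. by rewrite val_red_mul val_red_inv// granV. Qed.

Lemma red_composable a b : composable_for red_mul red_inv a b <->
  gsrc (\val a) = gran (\val b).
Proof.
rewrite -val_red_src -val_red_ran; split=> [->//|]; exact: val_inj.
Qed.

Lemma red_invK : involutive red_inv.
Proof. by move=> a; apply/val_inj; rewrite !val_red_inv ginvK. Qed.

Lemma red_mulA a b c :
  composable_for red_mul red_inv a b -> composable_for red_mul red_inv b c ->
  [/\ composable_for red_mul red_inv (red_mul a b) c,
      composable_for red_mul red_inv a (red_mul b c) &
      red_mul (red_mul a b) c = red_mul a (red_mul b c)].
Proof.
move=> /red_composable ab /red_composable bc.
have abc : gsrc (\val (red_mul a b)) = gran (\val c).
  by rewrite val_red_mul// gsrcM.
have abc' : gsrc (\val a) = gran (\val (red_mul b c)).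
  by rewrite val_red_mul// granM.
split; [exact/red_composable|exact/red_composable|apply/val_inj].
by rewrite (val_red_mul abc) (val_red_mul abc') !val_red_mul// gmulA.
Qed.

Lemma red_mulK a b : composable_for red_mul red_inv a b ->
  red_mul (red_inv a) (red_mul a b) = b /\ red_mul (red_mul a b) (red_inv b) = a.
Proof.
move=> /red_composable ab; split; apply/val_inj.
  by rewrite val_red_mul val_red_inv ?val_red_mul// ?gmulKl// gsrcV granM.
by rewrite val_red_mul val_red_inv ?val_red_mul// ?gmulKr// granV gsrcM.
Qed.

HB.instance Definition _ := isGroupoid.Build reduction red_invK red_mulA red_mulK.

Lemma val_gsrc a : \val (gsrc a) = gsrc (\val a).
Proof. exact: val_red_src. Qed.

Lemma val_gran a : \val (gran a) = gran (\val a).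
Proof. exact: val_red_ran. Qed.

Lemma val_gmul a b : gsrc a = gran b ->
  \val (gmul a b) = gmul (\val a) (\val b).
Proof. by move=> /(congr1 val) ab; apply: val_red_mul; rewrite -val_gsrc ab val_gran. Qed.

Lemma red_inv_continuous : continuous (ginv : reduction -> reduction).
Proof.
move=> a; apply: set_type_continuous.
rewrite (_ : _ \o _ = ginv \o (\val : reduction -> G)); last first.
  by apply/funext => b; exact: val_red_inv.
by apply: continuous_comp; [exact: val_continuous|exact: ginv_continuous].
Qed.

Lemma red_mul_continuous :
  {within [set p : reduction * reduction | gsrc p.1 = gran p.2],
    continuous (fun p : reduction * reduction => gmul p.1 p.2)}.
Proof.
apply/subspace_continuousP => -[a b] /= ab W [_ [[U oU <-] /= Uab UW]].
have gab : gsrc (\val a) = gran (\val b) by rewrite -val_gsrc ab val_gran.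
have nU : nbhs (gmul (\val a) (\val b)) U.
  by rewrite -val_gmul//; exact: open_nbhs_nbhs.
have gc := (subspace_continuousP _ _).1 (@gmul_continuous G)
  (\val a, \val b) gab U nU.
have vc : {for (a, b), continuous
    (fun p : reduction * reduction => (\val p.1 : G, \val p.2 : G))}.
  apply: cvg_pair; apply: continuous_comp;
    [exact: cvg_fst|exact: val_continuous|exact: cvg_snd|exact: val_continuous].
have := vc _ gc; rewrite !nbhs_simpl/= => nv.
apply: filterS nv => -[c d] /= H cd; apply: UW => /=.
rewrite -[X in U X]/(\val (gmul c d)) val_gmul//; apply: H; move/(congr1 val): cd.
by rewrite -[LHS]/(\val (gsrc c)) -[RHS]/(\val (gran d)) val_gsrc val_gran.
Qed.

HB.instance Definition _ := isTopologicalGroupoid.Build reduction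
  red_mul_continuous red_inv_continuous.

End ReductionGroupoid.

Section ReductionAmple.
Variables (G : ampleHausdorffGroupoidType) (V : closed_invariant G).
Local Notation H := (reduction V).
Local Notation vv := (fun u : unit_space H => src (\val (\val u : H) : G)).

Local Notation pre B := ((\val : H -> G) @^-1` B).

Lemma vv_continuous : continuous vv.
Proof.
move=> u; apply: (@continuous_comp _ _ _ (fun u : unit_space H => \val (\val u : H))).
  by apply: (@continuous_comp _ _ _ (\val : unit_space H -> H));
    exact: val_continuous.
exact: src_continuous.
Qed.

Lemma vvP u : ci_set V (vv u). Proof. exact: reductionP. Qed.

Lemma val_vv u : \val (vv u) = \val (\val u : H) :> G.
Proof.
have [a _ e] := set_valP u.
by rewrite /= -e val_gsrc gsrc_src.
Qed.

Lemma vv_inj : injective vv.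
Proof. by move=> u w /(congr1 val); rewrite !val_vv => /val_inj/val_inj. Qed.

Lemma reduction_homeo (B : set G) (f : G -> unit_space G)
    (f' : H -> unit_space H) :
  (forall a, vv (f' a) = f (\val a)) ->
  (forall a, ci_set V (f a) -> ci_set V (src a)) ->
  continuous f' ->
  homeomorphic_onto_open B f -> homeomorphic_onto_open (pre B) f'.
Proof.
move=> ff' fV cf' [g [_ cg gK oU]].
have imE : f' @` (pre B) = vv @^-1` (f @` B).
  apply/seteqP; split=> [_ [a Ba <-]|u [b Bb fb]].
    by exists (\val a) => //; rewrite ff'.
  have Vb : b \in @src G @^-1` ci_set V.
    by apply/mem_set/fV; rewrite fb; exact: vvP.
  exists (exist _ b Vb) => //; apply: vv_inj.
  by rewrite ff'.
have oim : open (f' @` (pre B)).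
  by rewrite imE; apply: open_comp => // u _; exact: vv_continuous.
pose g' (u : unit_space H) : H := insubd (\val u) (g (vv u)).
have g'E u : (f @` B) (vv u) -> \val (g' u) = g (vv u).
  move=> [b Bb fb]; rewrite insubdK//; apply/mem_set => /=; apply: fV.
  by rewrite -fb gK// fb; exact: vvP.
exists g'; split=> //.
- exact: continuous_subspaceT.
- apply/subspace_continuousP => u imu.
  suff cu : {for u, continuous g'} by apply: cvg_trans cu; exact/cvg_app/cvg_within.
  apply: set_type_continuous.
  have nu : \forall w \near u, (f @` B) (vv w).
    by rewrite imE in oim imu; exact: open_nbhs_nbhs.
  have cgu := within_continuous_comp_near cg (@vv_continuous u) nu.
  move=> W; rewrite /= g'E; last exact: nbhs_singleton nu.
  move=> /cgu nW; apply: (filterS2 _ _ nu nW) => w /g'E /= -> //.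
- move=> a Ba; apply/val_inj; rewrite g'E; first by rewrite ff' gK.
  by rewrite ff'; exists (\val a).
Qed.

Lemma vv_src (a : H) : vv (src a) = src (\val a).
Proof. by apply/val_inj; rewrite val_vv /= val_gsrc. Qed.

Lemma vv_ran (a : H) : vv (ran a) = ran (\val a).
Proof. by apply/val_inj; rewrite val_vv /= val_gran. Qed.

Lemma reduction_bisection (B : set G) :
  bisection B -> bisection (pre B).
Proof.
move=> [oB rB sB]; split.
- by apply: open_comp => // a _; exact: val_continuous.
- apply: reduction_homeo rB; [exact: vv_ran| |exact: ran_continuous].
  move=> a; have -> : ran a = src (ginv a).
    by apply/val_inj; rewrite /= gsrcV.
  move=> /ci_invariant; have -> // : ran (ginv a) = src a.
  by apply/val_inj; rewrite /= granV.
- by apply: reduction_homeo sB; [exact: vv_src| |exact: src_continuous].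
Qed.

Lemma reduction_compact (B : set G) :
  compact B -> compact (pre B).
Proof.
move=> cB; apply/compact_set_type.
have -> : \val @` (pre B) = B `&` (@src G @^-1` ci_set V).
  apply/seteqP; split=> [_ [a Ba <-]|a [Ba Va]].
    by split=> //; exact: reductionP.
  by exists (exist _ a (mem_set Va)).
apply: compact_closedI => //; apply: preimage_closed; last exact: ci_closed.
by move=> a _; exact: src_continuous.
Qed.

Lemma reduction_ample : ample H.
Proof.
have [Bs [oBs basisBs] Bsb] := @ample_subproof G.
exists [set (pre B) | B in Bs].
  split=> [_ [B /oBs oB <-]|a W [_ [[U oU <-] /= Ua UW]]].
    by apply: open_comp => // a _; exact: val_continuous.
  have [B [BsB Ba] BU] := basisBs (\val a) U (open_nbhs_nbhs (conj oU Ua)).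
  exists (pre B); first by split=> //; exists B.
  by move=> b Bb; apply/UW/BU.
move=> _ [B BsB <-]; have [cB bB] := Bsb B BsB.
by split; [exact: reduction_compact|exact: reduction_bisection].
Qed.

Lemma reduction_hausdorff : hausdorff_space H.
Proof. exact/set_type_hausdorff/hausdorff_subproof. Qed.

HB.instance Definition _ := isAmpleHausdorff.Build H
  reduction_ample reduction_hausdorff.

End ReductionAmple.

Definition strongly_effective (G : topGroupoidType) : Prop :=
  forall V : closed_invariant G, ci_set V !=set0 -> effective (reduction V).

Section OpenInvariantComplement.
Variables (G : topGroupoidType) (U : open_invariant G).

Lemma open_invariantC_closed : closed (~` oi_set U).
Proof. by rewrite closedC; exact: oi_open. Qed.

Lemma open_invariantC_invariant : invariant (~` oi_set U).
Proof.
move=> a sUa rUa; apply: sUa.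
have -> : src a = ran (ginv a) by apply/val_inj; rewrite /= granV.
apply: oi_invariant.
by have -> : src (ginv a) = ran a by apply/val_inj; rewrite /= gsrcV.
Qed.

Definition open_invariantC : closed_invariant G :=
  ClosedInvariant open_invariantC_closed open_invariantC_invariant.

End OpenInvariantComplement.

Section CharacteristicFunction.
Variable K : fieldType.

(* The element 1_B of the Steinberg algebra, for B compact open; the default
   value 0 is used for other sets. *)
Definition steinberg_char (G : topGroupoidType) (B : set G) : steinberg K G :=
  insubd 0 (fun a => (a \in B)%:R).

Definition unit_char (G : topGroupoidType) (V : set (unit_space G)) :
  steinberg K G := steinberg_char (\val @` V).

(* A subset of [V] is identified with a set of units of the reduction to [V]. *)
Definition reduction_char (G : topGroupoidType) (V : closed_invariant G)
    (W : set (unit_space G)) : steinberg K (reduction V) :=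
  steinberg_char [set a : reduction V | (\val @` W) (\val a)].

Lemma steinberg_charE (G : ampleHausdorffGroupoidType) (B : set G) :
  compact B -> open B ->
  steinberg_char B = (fun a => (a \in B)%:R) :> (G -> K).
Proof.
move=> cB oB; apply: (@insubdK _ _ (steinberg K G)); apply/steinberg_predP.
have clB : closed B by apply: compact_closed => //; exact: hausdorff_subproof.
split; last first.
  rewrite (_ : mkset _ = B)//; apply/seteqP; split=> a /=.
    by case: (boolP (a \in B)) => [/set_mem//|]; rewrite eqxx.
  by move=> /mem_set ->; rewrite oner_eq0.
move=> a; case: (boolP (a \in B)) => [/set_mem Ba|aB].
  have : \forall b \near a, B b by exact: open_nbhs_nbhs.
  by apply: filterS => b /mem_set ->.
have : \forall b \near a, (~` B) b.
  apply: open_nbhs_nbhs; split; first by rewrite openC.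
  by move=> /mem_set; rewrite (negPf aB).
by apply: filterS => b nBb; case: (boolP (b \in B)) => // /set_mem.
Qed.

Lemma unit_charE (G : ampleHausdorffGroupoidType) (V : set (unit_space G)) :
  compact V -> open V ->
  unit_char V = (fun a => (a \in \val @` V)%:R) :> (G -> K).
Proof.
move=> cV [W oW WV]; apply: steinberg_charE; first exact/compact_set_type.
have -> : \val @` V = W `&` (@units G).
  rewrite -WV; apply/seteqP; split=> [_ [u Wu <-]|a [Wa ua]].
    by split=> //; exact: set_valP.
  by exists (exist _ a (mem_set ua)).
by apply: openI => //; exact: units_open.
Qed.

Lemma reduction_charE (G : ampleHausdorffGroupoidType) (V : closed_invariant G)
    (W : set (unit_space G)) :
  W `<=` ci_set V -> compact W -> open (W : set (subspace (ci_set V))) ->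
  reduction_char V W =
    (fun a => ((\val a : G) \in \val @` W)%:R) :> (reduction V -> K).
Proof.
move=> WV cW /open_subspaceP[W' oW' eW].
rewrite /reduction_char steinberg_charE.
- by apply/funext => a; congr (_%:R); congr nat_of_bool; apply/idP/idP => /set_mem ?;
    exact/mem_set.
- apply/compact_set_type; rewrite (_ : _ @` _ = \val @` W).
    exact/compact_set_type.
  apply/seteqP; split=> [_ [a Wa <-]//|a Wa].
  suff Va : a \in @src G @^-1` ci_set V by exists (exist _ a Va).
  apply/mem_set; have [u Wu <-] := Wa; rewrite /preimage/=.
  have -> : src (\val u) = u by apply/val_inj/units_gsrc/set_valP.
  exact: WV.
- case: oW' => O oO OW'.
  have -> : [set a : reduction V | (\val @` W) (\val a)] =
      \val @^-1` (O `&` @units G).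
    have e u : (W' u /\ ci_set V u) = (W u /\ ci_set V u).
      exact: (congr1 (@^~ u) eW).
    apply/seteqP; split=> a /=.
      move=> [u Wu <-]; split; last exact: set_valP.
      by have [+ _] : W' u /\ ci_set V u; [rewrite e; split=> //; exact: WV|];
        rewrite -OW'.
    move=> [Oa ua]; exists (src (\val a)); last exact: units_gsrc.
    suff [] : W (src (\val a)) /\ ci_set V (src (\val a)) by [].
    rewrite -e; split; last exact: reductionP.
    by rewrite -OW' /=; have -> : set_val (src (\val a)) = \val a
      by exact: units_gsrc.
  apply: open_comp; first by move=> a _; exact: val_continuous.
  by apply: openI => //; exact: units_open.
Qed.

End CharacteristicFunction.

(* Main.v *)
Require Import Defs.
From mathcomp Require Import all_boot all_algebra ring_quotient.
From mathcomp Require Import all_classical topology.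

Set Implicit Arguments.
Unset Strict Implicit.
Unset Printing Implicit Defensive.

Import GRing.Theory.
Local Open Scope classical_set_scope.
Local Open Scope ring_scope.

(* (4) => (1) holds in every ring with local units. The elements x with
   a (+) x <~ a form an ideal K(a). If a were not in K(a), the right ideal
   generated by the image of a in R/K(a) would contain an infinite idempotent,
   so this image would be infinite; but any relation a (+) x <~ a modulo K(a)
   lifts to R, because elements of K(a) can be added to the entries of a matrix
   factoring through a. Hence a lies in K(a), i.e. a is properly infinite.

   (2) => (3): restricting functions to G_D sends 1_B to 1_(B \cap D), and an
   idempotent lying over a properly infinite idempotent is infinite.

   (3) => (4): by effectiveness of G_D, any f which does not vanish on G_D can
   be compressed to some x f y that agrees on G_D with 1_W, where W is compact
   open in the unit space and meets D. Thus each ideal of A_K(G) consists of the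
   functions vanishing on some G_D, so that the corresponding quotient is
   A_K(G_D), and each one-sided ideal of the quotient contains an idempotent
   equivalent to some 1_(W \cap D). *)

(** * Infinite elements of rings *)

Section Comparison.
Variable R : rngType.
Implicit Types (a b c e k l p v x y z w : R) (M : bool -> bool -> R).

Lemma precsim_mx1P m (M : 'M[R]_m) a : precsim M (mx1 a) <->
  exists z w : 'I_m -> R, forall i j, M i j = z i ** a ** w j.
Proof.
split=> [[x [y ->]]|[z [w zw]]].
  exists (x ^~ ord0), (y ord0) => i j.
  by rewrite /rmulmx !mxE big_ord1 !mxE big_ord1 !mxE.
exists (\col_i z i), (\row_j w j); apply/matrixP => i j.
by rewrite zw /rmulmx !mxE big_ord1 !mxE big_ord1 !mxE.
Qed.

(** Boolean indices replace the ordinals below 1 + 1, with [false] as the first index, so that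
    entries are reached by case analysis. *)
Definition factors a M : Prop :=
  exists z w : bool -> R, forall i j, z i ** a ** w j = M i j.

Definition diag2 b c : bool -> bool -> R :=
  fun i j => if i == j then (if i then c else b) else 0.

Lemma precsim_mx11P a b :
  precsim (mx1 b) (mx1 a) <-> exists r s, b = r ** a ** s.
Proof.
rewrite precsim_mx1P; split=> [[z [w zw]]|[r [s ->]]].
  by exists (z ord0), (w ord0); rewrite -zw mxE.
by exists (fun=> r), (fun=> s) => i j; rewrite mxE.
Qed.

Lemma precsim_dsumP a b c :
  precsim (dsum (mx1 b) (mx1 c)) (mx1 a) <-> factors a (diag2 b c).
Proof.
pose ix (i : bool) : 'I_(1 + 1) := if i then rshift 1 ord0 else lshift 1 ord0.
have ixE (i j : bool) : dsum (mx1 b) (mx1 c) (ix i) (ix j) = diag2 b c i j.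
  by case: i; case: j;
    rewrite /dsum /ix (block_mxEul, block_mxEur, block_mxEdl, block_mxEdr) mxE.
rewrite precsim_mx1P; split=> [[z [w zw]]|[z [w zw]]].
  by exists (z \o ix), (w \o ix) => i j; rewrite /= -zw ixE.
pose xi (i : 'I_(1 + 1)) := i != lshift 1 ord0.
have xiK i : ix (xi i) = i.
  by rewrite /xi; case: (splitP i) => j; rewrite (ord1 j) /= => ij;
    case: eqVneq => [->|]; rewrite // => /eqP H; apply/val_inj => /=;
    rewrite ij //; case: H; exact/val_inj.
exists (z \o xi), (w \o xi) => i j.
by rewrite /= zw -ixE !xiK.
Qed.

Lemma infinite_eltP a : infinite_elt a <->
  a != 0 /\ exists2 x, x != 0 & factors a (diag2 a x).
Proof.
by split=> -[a0 [x x0 /precsim_dsumP ax]]; split=> //; exists x.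
Qed.

Lemma properly_infinite_eltP a :
  properly_infinite_elt a <-> a != 0 /\ factors a (diag2 a a).
Proof. by split=> -[a0 /precsim_dsumP aa]. Qed.

Lemma factors_diag2P a b c : factors a (diag2 b c) <->
  exists z1 z2 w1 w2, [/\ z1 ** a ** w1 = b, z1 ** a ** w2 = 0,
    z2 ** a ** w1 = 0 & z2 ** a ** w2 = c].
Proof.
split=> [[z [w zw]]|[z1 [z2 [w1 [w2 [e1 e2 e3 e4]]]]]].
  by exists (z false), (z true), (w false), (w true); rewrite !zw.
exists (fun i : bool => if i then z2 else z1), (fun i : bool => if i then w2 else w1).
by case; case.
Qed.

(* If [a (+) k <~ a], a copy of [k] can be split off from [a] and used to
   change any single entry of a matrix factoring through [a]. *)
Lemma factors_add a M k (i0 j0 : bool) : factors a (diag2 a k) -> factors a M ->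
  factors a (fun i j => M i j + (if (i == i0) && (j == j0) then k else 0)).
Proof.
move=> /factors_diag2P[z1 [z2 [w1 [w2 [e1 e2 e3 e4]]]]] [z [w zw]].
exists (fun i => z i ** z1 + (if i == i0 then z2 else 0)),
  (fun j => w1 ** w j + (if j == j0 then w2 else 0)) => i j.
have F (s t s' t' : R) :
    s ** s' ** a ** (t' ** t) = s ** (s' ** a ** t') ** t.
  by rewrite !rmulA.
have F1 (s s' t' : R) : s ** s' ** a ** t' = s ** (s' ** a ** t').
  by rewrite !rmulA.
have F2 (t s' t' : R) : s' ** a ** (t' ** t) = s' ** a ** t' ** t.
  by rewrite !rmulA.
rewrite !rmulDl !rmulDr F e1 zw -addrA; congr (_ + _).
case: (i == i0); case: (j == j0);
  by rewrite ?F1 ?F2 ?e2 ?e3 ?e4 ?(rmul0l, rmul0r, add0r, addr0).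
Qed.

(** Two orthogonal copies of [a] inside [a] merge two terms [r a s] into a single one: the cross
    terms vanish because the off-diagonal entries are zero. *)
Lemma factors_sandwich a b :
  factors a (diag2 a a) -> sandwich a b -> exists r s, b = r ** a ** s.
Proof.
move=> /factors_diag2P[z1 [z2 [w1 [w2 [e1 e2 e3 e4]]]]] [n [r [s ->]]].
elim/big_ind: _ => [|_ _ [r1 [s1 ->]] [r2 [s2 ->]]|i _].
- by exists 0, 0; rewrite rmul0r.
- exists (r1 ** z1 + r2 ** z2), (w1 ** s1 + w2 ** s2).
  have F (x y x' y' : R) : x ** x' ** a ** (y' ** y) = x ** (x' ** a ** y') ** y.
    by rewrite !rmulA.
  by rewrite !rmulDl !rmulDr !F e1 e2 e3 e4 !rmul0r !rmul0l addr0 add0r.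
- by exists (r i), (s i).
Qed.

(** An idempotent can be doubled and absorbed on both sides, so that only products of two factors
    remain. *)
Lemma factors_idem e a b : e ** e = e -> factors e (diag2 a b) ->
  exists z1 z2 w1 w2, [/\ z1 ** e = z1, z2 ** e = z2, e ** w1 = w1, e ** w2 = w2 &
   [/\ z1 ** w1 = a, z1 ** w2 = 0, z2 ** w1 = 0 & z2 ** w2 = b]].
Proof.
move=> ee /factors_diag2P[z1 [z2 [w1 [w2 [e1 e2 e3 e4]]]]].
exists (z1 ** e), (z2 ** e), (e ** w1), (e ** w2).
by split; [..|split]; rewrite ?rmulA -?(rmulA _ e e) ee // ?e1.
Qed.

(** Put [S = p s] and [T = t p]. Then [S T = p] and [T S = t p s], so the two idempotents are
    equivalent and infiniteness passes from one to the other. *)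
Lemma infinite_idem_equiv p s t : idempotent_elt p -> infinite_elt p ->
  s ** t = p -> idempotent_elt (t ** p ** s) /\ infinite_elt (t ** p ** s).
Proof.
move=> pp /infinite_eltP[p0 [x x0 px]] st.
have eE : t ** p ** s = (t ** p) ** (p ** s) by rewrite rmulA -(rmulA t p p) pp.
have STE : (p ** s) ** (t ** p) = p by rewrite rmulA -(rmulA p s t) st pp pp.
have pS : p ** (p ** s) = p ** s by rewrite rmulA pp.
have Tp : (t ** p) ** p = t ** p by rewrite -rmulA pp.
rewrite eE; move: (p ** s) (t ** p) STE pS Tp => S T ST pS Tp {eE}.
split; first by rewrite /idempotent_elt rmulA -(rmulA T S T) ST Tp.
apply/infinite_eltP; split.
  by apply: contra_neq p0 => e0; rewrite -pp -ST rmulA -(rmulA S) e0 rmul0r rmul0l.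
exists x => //; have [z1 [z2 [w1 [w2 [h1 h2 h3 h4 [e1 e2 e3 e4]]]]]] := factors_idem pp px.
(* An outer [T] on the first row and an outer [S] on the first column turn the corner [p] into
   [T S]; the corner [x] stays as it is. *)
apply/factors_diag2P; exists (T ** z1 ** S), (z2 ** S), (T ** w1 ** S), (T ** w2).
have F (y y' : R) : y ** p = y -> y ** S ** (T ** S) ** (T ** y') = y ** y'.
  by move=> yp; rewrite -!rmulA (rmulA S T) ST (rmulA S T) ST !rmulA !yp.
have Tz1 : T ** z1 ** p = T ** z1 by rewrite -rmulA h1.
split.
- by rewrite -(rmulA T w1 S) F// -(rmulA T z1) (rmulA z1) e1 rmulA Tp.
- by rewrite F// -rmulA e2 rmul0r.
- by rewrite -(rmulA T w1 S) F// rmulA e3 rmul0l.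
- by rewrite F.
Qed.

(** [v] is the orthogonal sum of [p] and [v - p]. Two copies of [p] fit into [p]; leaving [v - p]
    beside the first one gives [v (+) p <~ v]. *)
Lemma infinite_over_properly_infinite p v : idempotent_elt p -> idempotent_elt v ->
  p ** v = p -> v ** p = p -> properly_infinite_elt p -> infinite_elt v.
Proof.
move=> pp vv pv vp /properly_infinite_eltP[p0 /factors_idem-/(_ pp)].
move=> [z1 [z2 [w1 [w2 [h1 h2 h3 h4 [e1 e2 e3 e4]]]]]].
apply/infinite_eltP; split; first by apply: contra_neq p0 => v0; rewrite -pv v0 rmul0r.
exists p => //; apply/factors_diag2P.
pose q := v - p.
have pq : p ** q = 0 by rewrite rmulBr pv pp subrr.
have qp : q ** p = 0 by rewrite rmulBl vp pp subrr.
have qq : q ** q = q by rewrite rmulBr rmulBl vv pv -/q qp subr0.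
have zv z : z ** p = z -> z ** v = z by move=> <-; rewrite -rmulA pv.
have zq z : z ** p = z -> z ** q = 0 by move=> <-; rewrite -rmulA pq rmul0r.
have qw w : p ** w = w -> q ** w = 0 by move=> <-; rewrite rmulA qp rmul0l.
have qv : q ** v = q by rewrite rmulBl vv pv.
have vE : p + q = v by rewrite addrC subrK.
clearbody q; pose u1 := p ** z1 + q; exists u1, (p ** z2), (w1 ** p + q), (w2 ** p).
have u1v : u1 ** v = u1 by rewrite rmulDl qv -rmulA zv.
have z2v : p ** z2 ** v = p ** z2 by rewrite -rmulA zv.
rewrite u1v z2v; split.
- rewrite /u1 rmulDl !rmulDr (rmulA q) (qw w1)// rmul0l add0r qq -(rmulA p z1 q) (zq z1)//.
  by rewrite rmul0r addr0 -rmulA (rmulA z1) e1 pp pp vE.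
- by rewrite /u1 rmulDl (rmulA q) (qw w2)// rmul0l addr0 -rmulA (rmulA z1) e2 rmul0l rmul0r.
- by rewrite rmulDr -(rmulA p z2 q) (zq z2)// rmul0r addr0 -rmulA (rmulA z2) e3 rmul0l rmul0r.
- by rewrite -rmulA (rmulA z2) e4 pp pp.
Qed.

End Comparison.

Lemma rng_pi0 (R : rngType) (I : ideal R) : rng_pi I 0 = 0.
Proof. by rewrite /rng_pi raddf0. Qed.

Lemma quot_rmul (R : rngType) (I : ideal R) x y :
  rng_pi I x ** rng_pi I y = rng_pi I (x ** y).
Proof. exact: rng_piM. Qed.

(** * The ideal K(a) of elements absorbed by [a] *)

Section Absorption.
Variable R : rngType.
Implicit Types (a b e k l x y : R).

(** The relation for [e] is enlarged by the complement [l - e], which is left fixed: [a] is moved to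
    [(l - e + w1) a], and this leaves room for [x]. As [e = a y], the move can be made by a factor
    to the right of [a]. *)
Lemma infinite_of_idempotent_multiple a e l y : l ** a = a -> a ** l = a ->
  e = a ** y -> idempotent_elt e -> infinite_elt e -> infinite_elt a.
Proof.
move=> la al eE ee /infinite_eltP[e0 [x x0 ex]]; apply/infinite_eltP.
split; first by apply: contra_neq e0 => a0; rewrite eE a0 rmul0l.
exists x => //; apply/factors_diag2P.
have [z1 [z2 [w1 [w2 [h1 h2 h3 h4 [e1 e2 e3 e4]]]]]] := factors_idem ee ex.
(* [d] is chosen so that [a (l + y d) = (l - e + w1) a]; multiplication by [u] brings this back to
   [a]. *)
pose u := l - e + e ** z1; pose d := (w1 - e) ** a.
have le : l ** e = e by rewrite eE rmulA la.
have uw w : e ** w = w -> u ** w = e ** z1 ** w.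
  move=> ew; rewrite /u rmulDl rmulBl ew -{1}ew rmulA le ew subrr add0r //.
have ua : u ** a = a - e ** a + e ** z1 ** a by rewrite /u rmulDl rmulBl la.
have av : a ** (l + y ** d) = a + d.
  by rewrite rmulDr al rmulA -eE /d rmulA rmulBr h3 ee.
exists u, z2, (l + y ** d), (y ** w2); split.
- rewrite -rmulA av rmulDr ua /d rmulA rmulBr !uw// -[e ** z1 ** w1]rmulA e1 ee.
  by rewrite -(rmulA e z1 e) h1 rmulBl addrACA subrK subrr addr0.
- by rewrite -rmulA (rmulA a) -eE h4 uw// -rmulA e2 rmul0r.
- by rewrite -rmulA av rmulDr /d rmulA rmulBr e3 sub0r h2 rmulNl subrr.
- by rewrite -rmulA (rmulA a) -eE h4 e4.
Qed.

Definition absorbed a : set R := [set x | factors a (diag2 a x)].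

Lemma eq_factors a (M N : bool -> bool -> R) :
  (forall i j, M i j = N i j) -> factors a M -> factors a N.
Proof. by move=> MN [z [w zw]]; exists z, w => i j; rewrite zw. Qed.

Lemma absorbed_mull a r x : absorbed a x -> absorbed a (r ** x).
Proof.
move=> /factors_diag2P[z1 [z2 [w1 [w2 [e1 e2 e3 e4]]]]]; apply/factors_diag2P.
by exists z1, (r ** z2), w1, w2; rewrite -!(rmulA r) e1 e2 e3 e4 rmul0r.
Qed.

Lemma absorbed_mulr a r x : absorbed a x -> absorbed a (x ** r).
Proof.
move=> /factors_diag2P[z1 [z2 [w1 [w2 [e1 e2 e3 e4]]]]]; apply/factors_diag2P.
by exists z1, z2, w1, (w2 ** r); rewrite !rmulA e1 e2 e3 e4 rmul0l.
Qed.

Variables (a l : R).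
Hypotheses (la : l ** a = a) (al : a ** l = a).

Lemma absorbed_additive : additive_subgroup (absorbed a).
Proof.
have a0 : absorbed a 0.
  by apply/factors_diag2P; exists l, 0, l, 0; rewrite la al !(rmul0l, rmul0r).
have aN x : absorbed a x -> absorbed a (- x).
  move=> /factors_diag2P[z1 [z2 [w1 [w2 [e1 e2 e3 e4]]]]]; apply/factors_diag2P.
  by exists z1, (- z2), w1, w2; rewrite !rmulNl e1 e2 e3 e4 oppr0.
(* Adding [- y] at the lower right corner turns [diag(a, x)] into [diag(a, x - y)]. *)
split=> // x y ax /aN ay; have := factors_add true true ay ax.
by apply: eq_factors => -[] [] /=; rewrite /diag2/= ?addr0.
Qed.

Definition absorbed_ideal : ideal R :=
  Ideal (conj absorbed_additive (@absorbed_mull a))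
        (conj absorbed_additive (@absorbed_mulr a)).

(** Lifting a relation [a (+) x' <~ a] to the ring leaves four errors [k i j], all absorbed by [a].
    [factors_add] corrects them one entry at a time, so the lift [x] of [x'] is absorbed as well and
    [x' = 0]. *)
Lemma quotient_absorbed_finite : ~ infinite_elt (rng_pi absorbed_ideal a).
Proof.
pose pi := rng_pi absorbed_ideal.
move=> /infinite_eltP[_ [x' x0 [z' [w' zw]]]].
pose z i := repr (z' i : Quotient.quot (ideal_pred absorbed_ideal)).
pose w i := repr (w' i : Quotient.quot (ideal_pred absorbed_ideal)).
pose x := repr (x' : Quotient.quot (ideal_pred absorbed_ideal)).
have xE : pi x = x' by exact: rng_piK.
pose k i j := diag2 a x i j - z i ** a ** w j.
have ak i j : absorbed a (k i j).
  suff : pi (diag2 a x i j) = pi (z i ** a ** w j) by move/rng_pi_eq.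
  rewrite /pi -!quot_rmul.
  rewrite -[rng_pi _ (z i)]/(pi _) -[rng_pi _ (w j)]/(pi _).
  have -> : pi (z i) = z' i by exact: rng_piK.
  have -> : pi (w j) = w' j by exact: rng_piK.
  rewrite zw -xE /diag2; case: (i == j); first by case: i.
  exact: rng_pi0.
have : factors a (fun i j => z i ** a ** w j) by exists z, w.
move=> /(factors_add false false (ak false false)).
move=> /(factors_add false true (ak false true)).
move=> /(factors_add true false (ak true false)).
move=> /(factors_add true true (ak true true)) F.
have ax : absorbed a x.
  by apply: eq_factors F => i j; case: i; case: j; rewrite /= ?addr0 addrC subrK.
suff : x' = 0 by apply/eqP.
rewrite -xE -[0](rng_pi0 absorbed_ideal).
by apply/rng_pi_eq; rewrite subr0.
Qed.

End Absorption.

Lemma properly_purely_infinite_of_idempotents (R : rngType) :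
  (forall a : R, exists2 l, l ** a = a & a ** l = a) ->
  (forall (I : ideal R) (J : set (rng_quotient I)), right_ideal J ->
    (exists2 x, J x & x != 0) ->
    exists2 e, J e & idempotent_elt e /\ infinite_elt e) ->
  properly_purely_infinite R.
Proof.
move=> unitR infJ a a0; have [l la al] := unitR a.
pose I := absorbed_ideal la al; pose b := rng_pi I a.
apply/properly_infinite_eltP; split=> //; apply: contrapT => na.
have lb : rng_pi I l ** b = b by rewrite quot_rmul la.
have bl : b ** rng_pi I l = b by rewrite quot_rmul al.
have [||_ [y _ <-] [ee einf]] := infJ I [set b ** y | y in setT].
- split; first split; first by exists 0; rewrite ?rmul0r.
    by move=> _ _ [y _ <-] [y' _ <-]; exists (y - y'); rewrite ?rmulBr.
  by move=> r _ [y _ <-]; exists (y ** r); rewrite ?rmulA.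
- exists b; first by exists (rng_pi I l).
  apply/eqP => b0; apply: na; suff : ideal_set I (a - 0) by rewrite subr0.
  by apply/rng_pi_eq; rewrite -/b b0 rng_pi0.
apply: (@quotient_absorbed_finite _ _ _ la al).
exact: infinite_of_idempotent_multiple lb bl erefl ee einf.
Qed.

(** If a quotient were a division ring, a lift of its identity would be properly infinite. This
    would give [z1 w1 = z2 w2 = 1] and [z1 w2 = 0] in the quotient, which is impossible without zero
    divisors. *)
Lemma properly_purely_infinite_purely_infinite (R : rngType) :
  properly_purely_infinite R -> purely_infinite R.
Proof.
move=> ppi; split=> [I [e [e0 e1 eV]]|a b ab]; last first.
  apply/precsim_mx11P; have [a0|a0] := eqVneq a 0; last first.
    by apply: factors_sandwich ab; have /properly_infinite_eltP[] := ppi a a0.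
  exists 0, 0; have [n [r [s ->]]] := ab.
  by rewrite rmul0r big1// => i _; rewrite a0 rmul0r rmul0l.
pose a := repr (e : Quotient.quot (ideal_pred I)).
have ae : rng_pi I a = e by exact: rng_piK.
have a0 : a != 0 by apply: contra_neq e0 => a0; rewrite -ae a0 rng_pi0.
have /properly_infinite_eltP[_ /factors_diag2P] := ppi a a0.
move=> [z1 [z2 [w1 [w2 [h1 h2 _ h4]]]]].
have zw z w x : z ** a ** w = x -> rng_pi I z ** rng_pi I w = rng_pi I x.
  by move=> <-; rewrite -!quot_rmul ae (e1 _).2.
have : rng_pi I z1 ** rng_pi I w2 = 0 by rewrite (zw _ _ _ h2) rng_pi0.
have [z0|z0] := eqVneq (rng_pi I z1) 0.
  by move=> _; move: (zw _ _ _ h1); rewrite z0 rmul0l ae => /esym/eqP; apply/negP.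
have [y [_ yz]] := eV _ z0; move=> /(congr1 (rmul y)).
rewrite rmulA yz (e1 _).1 rmul0r => w0.
by move: (zw _ _ _ h4); rewrite w0 rmul0r ae => /esym/eqP; apply/negP.
Qed.

(** * Steinberg algebras *)

(** Near-covering compactness is applied to the filter generated by the finite lists of indices in
    [P], ordered by inclusion. A list as outcome allows induction on the cover. *)
Lemma compact_seq_cover (T : topologicalType) (I : eqType) (P : set I)
    (F : I -> set T) (C : set T) : compact C ->
  (forall a, C a -> exists i, [/\ P i, open (F i) & F i a]) ->
  exists2 s : seq I, (forall i, i \in s -> P i) &
    C `<=` [set a | exists2 i, i \in s & F i a].
Proof.
move=> /compact_near_coveringP cC CF.
pose good (s : seq I) := forall i, i \in s -> P i.
pose Fs := filter_from good (fun s => [set t | good t /\ {subset s <= t}]).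
have FF : Filter Fs.
  apply: filter_from_filter; first by exists [::].
  move=> s t gs gt; exists (s ++ t).
    by move=> i; rewrite mem_cat => /orP[/gs|/gt].
  by move=> u [gu stu]; split; split=> // i si; apply: stu;
    rewrite mem_cat si ?orbT.
have [|s gs sC] := cC _ Fs (fun s a => exists2 i, i \in s & F i a) FF.
  move=> a Ca; have [i [Pi oFi Fia]] := CF a Ca.
  exists (F i, [set t | good t /\ {subset [:: i] <= t}]).
    split=> /=; first exact: open_nbhs_nbhs.
    by exists [:: i] => // j; rewrite inE => /eqP ->.
  by move=> [b t] /= [Fb [gt it]]; exists i => //; apply: it; rewrite inE.
by exists s => // a; exact: (sC s (conj gs (fun _ h => h))) a.
Qed.

(** * Products in the Steinberg algebra and local units *)

Section SteinbergProducts.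
Variables (K : fieldType) (G : ampleHausdorffGroupoidType).
Implicit Types (a b : G) (f g h : steinberg K G) (B C W : set G).

Lemma steinberg_ext f g : (forall a, f a = g a) -> f = g.
Proof. by move=> fg; apply/val_inj/funext. Qed.

Lemma steinbergDE f g a : (f + g) a = f a + g a.
Proof. by []. Qed.

Lemma steinbergBE f g a : (f - g) a = f a - g a.
Proof. by []. Qed.

Lemma mem_steinberg_scale (c : K) f : (fun a => c * f a) \in @steinberg_pred K G.
Proof.
have [lf cf] := (steinberg_predP _).1 (steinbergP f).
have lc : locally_constant (fun a => c * f a).
  by move=> a; apply: filterS (lf a) => b ->.
apply/steinberg_predP; split=> //; apply: subclosed_compact cf _.
  by rewrite -locally_constant_supp//; exact: closed_closure.
by move=> a /=; apply: contra_neq => ->; rewrite mulr0.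
Qed.

Definition steinberg_scale c f : steinberg K G := Steinberg (mem_steinberg_scale c f).

Lemma compact_open_nbhs a (U : set G) : nbhs a U ->
  exists B, [/\ compact B, open B, B a & B `<=` U].
Proof.
have [Bs [_ basisBs] cBs] := @ample_subproof G.
move=> /basisBs[B [BsB Ba] BU]; have [cB [oB _ _]] := cBs B BsB.
by exists B.
Qed.

Lemma steinberg_char_at B a : compact B -> open B ->
  steinberg_char K B a = (a \in B)%:R.
Proof. by move=> cB oB; rewrite steinberg_charE. Qed.

Lemma bisection_src_inj B a b : bisection B -> B a -> B b ->
  gsrc a = gsrc b -> a = b.
Proof.
move=> [_ _ [g [_ _ gK _]]] Ba Bb /src_eq ab.
by rewrite -(gK _ Ba) ab gK.
Qed.

Lemma rmul_point_left f g a b : gran b = gran a ->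
  (forall b', gran b' = gran a -> f b' != 0 -> b' = b) ->
  (f ** g) a = f b * g (gmul (ginv b) a).
Proof.
move=> ba fb; rewrite -[LHS]/(convolution f g a).
rewrite (@convolutionE _ _ _ _ _ [set b]) ?fsbig_set1//; first by move=> _ ->.
Qed.

Lemma rmul_point_right f g a b : gsrc b = gsrc a ->
  (forall b', gsrc b' = gsrc a -> g b' != 0 -> b' = b) ->
  (f ** g) a = f (gmul a (ginv b)) * g b.
Proof.
move=> ba gb; rewrite -[LHS]/(convolution f g a) /convolution.
have abV : gsrc a = gran (ginv b) by rewrite granV.
have e : gmul (ginv (gmul a (ginv b))) a = b.
  rewrite -{2}[a](@gmulKr _ a (ginv b)) // ginvK; apply: gmulKl; rewrite gsrcM// gsrcV //.
rewrite -(@fsbig_widen _ _ _ _ [set gmul a (ginv b)]) ?fsbig_set1 ?e//.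
- by move=> _ -> /=; rewrite granM.
- move=> c [/= ca nc].
  have ca' : gsrc (ginv c) = gran a by rewrite gsrcV.
  have [->|gc] := eqVneq (g (gmul (ginv c) a)) 0; first by rewrite mulr0.
  case: nc => /=; rewrite -(gb _ _ gc) ?gsrcM//.
  set d := gmul (ginv c) a; have cd : gsrc c = gran d by rewrite granM// granV.
  by rewrite -{1}[a](@gmulVK _ c a) // gmulKr.
Qed.

Lemma rmul_units_left h f a : (forall b, h b != 0 -> units b) ->
  (h ** f) a = h (gran a) * f a.
Proof.
move=> hu; rewrite (@rmul_point_left _ _ _ (gran a)) ?gran_ran//.
  by congr (_ * f _); rewrite -{2}[a]gmul_ran gmulKl// gsrc_ran.
by move=> b ba /hu /units_gran; rewrite ba.
Qed.

Lemma rmul_units_right f h a : (forall b, h b != 0 -> units b) ->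
  (f ** h) a = f a * h (gsrc a).
Proof.
move=> hu; rewrite (@rmul_point_right _ _ _ (gsrc a)) ?gsrc_src//.
  by congr (f _ * _); rewrite -{1}[a]gmul_src gmulKr// gran_src.
by move=> b ba /hu /units_gsrc; rewrite ba.
Qed.

Lemma char_units W : compact W -> open W -> W `<=` @units G ->
  forall a, steinberg_char K W a != 0 -> units a.
Proof.
move=> cW oW Wu a; rewrite steinberg_char_at//.
by case: (boolP (a \in W)) => [/set_mem/Wu//|]; rewrite eqxx.
Qed.

Lemma char_idempotent W : compact W -> open W -> W `<=` @units G ->
  idempotent_elt (steinberg_char K W).
Proof.
move=> cW oW Wu; apply: steinberg_ext => a.
rewrite rmul_units_left; last exact: char_units.
rewrite !steinberg_char_at//; case: (boolP (a \in W)) => aW; last by rewrite mulr0.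
by rewrite units_gran ?aW ?mulr1//; exact/Wu/set_mem.
Qed.

Lemma units_closed : closed (@units G).
Proof.
rewrite (_ : @units G = [set a | gsrc a = a]); last first.
  by apply/seteqP; split=> a; [exact: units_gsrc|move=> <-; exact: units_src].
by apply: closed_eq_fun; [exact: hausdorff_subproof|exact: gsrc_continuous|move=> x; exact: cvg_id].
Qed.

Lemma compact_open_bigcup (s : seq (set G)) :
  (forall B, B \in s -> compact B /\ open B) ->
  let V := [set a | exists2 B, B \in s & B a] in compact V /\ open V.
Proof.
elim: s => [_|B s IH sB] /=.
  rewrite (_ : mkset _ = set0); last by apply/seteqP; split=> // a [].
  by split; [exact: compact0|exact: open0].
have [cB oB] := sB B (mem_head _ _).
have [|cV oV] := IH; first by move=> C Cs; apply: sB; rewrite inE Cs orbT.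
rewrite (_ : mkset _ = B `|` [set a | exists2 B, B \in s & B a]).
  by split; [exact: compactU|exact: openU].
apply/seteqP; split=> a.
  by move=> [C]; rewrite inE => /orP[/eqP ->|Cs Ca]; [left|right; exists C].
move=> [Ba|[C Cs Ca]]; [exists B|exists C] => //; by rewrite inE ?eqxx// Cs orbT.
Qed.

Lemma compact_open_units_cover C : compact C -> C `<=` @units G ->
  exists W, [/\ compact W, open W, W `<=` @units G & C `<=` W].
Proof.
move=> cC Cu; have [s sB Cs] := compact_bisection_cover cC.
have [|cV oV] := @compact_open_bigcup s; first by move=> B /sB[? []].
set V := mkset _ in cV oV; exists (V `&` @units G); split=> //.
- by apply: compact_closedI => //; exact: units_closed.
- by apply: openI => //; exact: units_open.
- by move=> a Ca; split; [exact: Cs|exact: Cu].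
Qed.

(** The ranges and sources of the support form a compact set of units. The characteristic function
    of a compact open set of units containing it is a unit for [f] on both sides. *)
Lemma steinberg_local_unit f : exists2 l, l ** f = f & f ** l = f.
Proof.
have [_ cf] := (steinberg_predP _).1 (steinbergP f).
set F := mkset _ in cf.
have im (u : G -> G) : continuous u -> compact (u @` F).
  by move=> cu; apply: continuous_compact => //; exact: continuous_subspaceT.
have cRS := compactU (im _ (@gran_continuous G)) (im _ (@gsrc_continuous G)).
have [|W [cW oW Wu RSW]] := compact_open_units_cover cRS.
  by move=> _ [] [a _ <-]; [exact: units_ran|exact: units_src].
exists (steinberg_char K W); apply: steinberg_ext => a.
  rewrite rmul_units_left ?steinberg_char_at//; last exact: char_units.
  have [->|fa] := eqVneq (f a) 0; first by rewrite mulr0.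
  by rewrite mem_set ?mul1r//; apply: RSW; left; exists a.
rewrite rmul_units_right ?steinberg_char_at//; last exact: char_units.
have [->|fa] := eqVneq (f a) 0; first by rewrite mul0r.
by rewrite mem_set ?mulr1//; apply: RSW; right; exists a.
Qed.

End SteinbergProducts.

(** * Restriction of functions to [G_D] *)

Section Restriction.
Variables (K : fieldType) (G : ampleHausdorffGroupoidType).
Variable (D : closed_invariant G).
Implicit Types (f g : steinberg K G) (h : steinberg K (reduction D)).
Local Notation H := (reduction D).

Lemma mem_steinberg_res f : (fun a : H => f (\val a)) \in @steinberg_pred K H.
Proof.
have [lf cf] := (steinberg_predP _).1 (steinbergP f).
apply/steinberg_predP; split; last exact: (reduction_compact cf).
by move=> a; have := @val_continuous _ _ a _ (lf (\val a)).
Qed.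

Definition steinberg_res f : steinberg K H := Steinberg (mem_steinberg_res f).

Lemma val_ginv (a : H) : \val (ginv a) = ginv (\val a).
Proof. exact: val_red_inv. Qed.

(** As [D] is invariant, an element of [G] whose range lies in [D] belongs to the reduction, so both
    convolutions sum over the same fibre. *)
Lemma steinberg_resM f g : steinberg_res (f ** g) = steinberg_res f ** steinberg_res g.
Proof.
apply: steinberg_ext => a.
rewrite -[LHS]/(convolution f g (\val a)).
rewrite -[RHS]/(convolution (steinberg_res f) (steinberg_res g) a) /convolution.
rewrite (@reindex_fsbig _ _ _ _ _ (\val : H -> G) [set b | gran b = gran a]).
  apply: eq_fsbigr => b /set_mem /= ba; congr (_ * g _).
  by rewrite val_gmul ?gsrcV// val_ginv.
split=> [b /= ba|b c _ _|b /= ba]; [by rewrite -!val_gran ba|exact: val_inj|].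
have Db : b \in @src G @^-1` ci_set D.
  apply/mem_set => /=; have -> : src b = ran (ginv b).
    by apply/val_inj; rewrite /= granV.
  apply: ci_invariant; have -> : src (ginv b) = ran (\val a).
    by apply/val_inj; rewrite /= gsrcV ba.
  exact: reduction_ran.
exists (exist _ b Db) => //=.
by apply: val_inj; rewrite !val_gran.
Qed.

(** The support is covered by finitely many compact open sets of [G] on whose traces [h] is
    constant; the extension is then built one set at a time. *)
Lemma steinberg_res_surj h : exists f, steinberg_res f = h.
Proof.
have [lh ch] := (steinberg_predP _).1 (steinbergP h).
pose P := [set B : set G | [/\ compact B, open B &
  exists c, forall a : H, B (\val a) -> h a = c]].
have [|s sP sh] := @compact_seq_cover _ _ P
    (fun B : set G => (\val : H -> G) @^-1` B) _ ch.
  move=> a _; have [_ [[U oU <-] /= Ua UW]] := lh a.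
  have [B [cB oB Ba BU]] := compact_open_nbhs (open_nbhs_nbhs (conj oU Ua)).
  exists B; split=> //; last by apply: open_comp => // b _; exact: val_continuous.
  by split=> //; exists (h a) => b /BU; exact: UW.
suff [f fE] : exists f : steinberg K G, forall a : H,
    f (\val a) = if has (fun B => \val a \in B) s then h a else 0.
  exists f; apply: steinberg_ext => a; rewrite -[LHS]/(f (\val a)) fE.
  case: ifPn => // /hasPn sa; have [->//|ha] := eqVneq (h a) 0.
  by have [B Bs Ba] := sh a ha; have := sa B Bs; rewrite mem_set.
elim: s sP {sh} => [|B s IH] sP; first by exists 0.
have [cB oB [c hc]] := sP B (mem_head _ _).
have [|f fE] := IH; first by move=> C Cs; apply: sP; rewrite inE Cs orbT.
pose f1 := Steinberg (steinberg_restrict cB oB (steinbergP f)).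
(* On [B] the earlier extension is replaced by the constant [c]; outside [B] it is kept. *)
exists (steinberg_scale c (steinberg_char K B) + (f - f1)) => a.
rewrite steinbergDE steinbergBE.
rewrite -[steinberg_scale _ _ _]/(c * steinberg_char K B (\val a)).
rewrite -[f1 _]/(if \val a \in B then f (\val a) else 0) steinberg_char_at//= fE.
case: (boolP (\val a \in B)) => [aB|_] /=; last by rewrite mulr0 subr0 add0r.
by rewrite subrr addr0 mulr1 (hc a)//; exact: set_mem aB.
Qed.

Lemma steinberg_res_eqP f g : steinberg_res f = steinberg_res g <->
  forall a, ci_set D (src a) -> f a = g a.
Proof.
split=> [fg a Da|fg]; last first.
  by apply: steinberg_ext => a; apply: fg; exact: reductionP.
have Da' : a \in @src G @^-1` ci_set D by exact: mem_set.
by have /(congr1 (fun h : steinberg K H => h (exist _ a Da'))) := fg.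
Qed.

End Restriction.

(** * Effectiveness and sets of units moved off themselves by bisections *)

Section LocalReduction.
Variables (G : ampleHausdorffGroupoidType) (D : closed_invariant G).
Hypothesis effD : effective (reduction D).
Implicit Types (W B : set G) (a b : G).

Definition touches W := exists2 a, W a & ci_set D (src a).

(** With [W] a set of units and a function supported on [B], compressing the function by [1_W] on
    both sides leaves only units over [D]. *)
Definition displaced W B := forall b, B b -> ~ units b -> ci_set D (src b) ->
  W (gran b) -> ~ W (gsrc b).

(* Effectiveness yields an [e] in [B] over [D] whose source and range are
   different points of [W]; as [B] is the graph of a homeomorphism, a small
   enough neighbourhood of the range of [e] is moved off itself. *)
Lemma separate_bisection W B : compact W -> open W -> touches W -> bisection B ->
  exists W', [/\ compact W', open W', touches W', W' `<=` W & displaced W' B].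
Proof.
move=> cW oW mW bB; have [oB rB _] := bB.
have [sWB|/existsNP[b0]] := pselect (displaced W B); first by exists W; split.
move=> /not_implyP[Bb0 /not_implyP[ub0 /not_implyP[Db0 /not_implyP[Wr /contrapT Ws]]]].
pose O := B `&` ~` @units G `&` (@gran G @^-1` W `&` @gsrc G @^-1` W).
have oO : open O.
  apply: openI; [apply: openI => //|apply: openI].
  - by rewrite openC; exact: units_closed.
  - by apply: open_comp => // a _; exact: gran_continuous.
  - by apply: open_comp => // a _; exact: gsrc_continuous.
have [e [Oe De er]] : exists e, [/\ O e, ci_set D (src e) & gsrc e <> gran e].
  (* Otherwise the trace of [O] on the reduction would be an open set of isotropy around [b0], and
     effectiveness would make [b0] a unit. *)
  apply: contrapT => nO.
  have Db0' : b0 \in @src G @^-1` ci_set D by exact: mem_set.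
  pose b0' : reduction D := exist _ b0 Db0'.
  suff : interior (@isotropy (reduction D)) b0'.
    rewrite effD => -[c _ /(congr1 val)]; rewrite val_gsrc /= => cb.
    by apply: ub0; rewrite -cb; exact: units_src.
  have oO' : open ((\val : reduction D -> G) @^-1` O).
    by apply: open_comp => // c _; exact: val_continuous.
  have Ob0 : ((\val : reduction D -> G) @^-1` O) b0' by split.
  apply: filterS (open_nbhs_nbhs (conj oO' Ob0)) => c Oc.
  apply/val_inj; rewrite val_gsrc val_gran; apply: contrapT => cc; apply: nO.
  by exists (\val c); split=> //; exact: reductionP.
have [[Be _] [Wre Wse]] := Oe.
have /eqP er' := er; have := @hausdorff_subproof G; rewrite open_hausdorff.
move=> /(_ _ _ er')[[Q P] /= [/set_mem Qe /set_mem Pe] [oQ oP /eqP QP]].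
have [k [_ ck kK oU]] := rB.
have sre : src (gran e) = ran e by apply/val_inj; rewrite /= gsrc_ran.
have nU : \forall w \near gran e, (@ran G @` B) (src w).
  apply: (@src_continuous G); apply: open_nbhs_nbhs; split=> //.
  by exists e.
have ck' : {for gran e, continuous (fun w => gsrc (k (src w)))}.
  apply: (@continuous_comp _ _ _ (fun w => k (src w))); last exact: gsrc_continuous.
  exact: within_continuous_comp_near ck (@src_continuous G _) nU.
(* For a unit [w] near [gran e], [k (src w)] is the element of [B] with range [w]. Its source stays
   in [Q], while [w] stays in [P], which is disjoint from [Q]. *)
have nQ : \forall w \near gran e, Q (gsrc (k (src w))).
  apply: ck'; rewrite sre kK//; exact: open_nbhs_nbhs.
have nP : \forall w \near gran e, P w by exact: open_nbhs_nbhs.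
have nW : \forall w \near gran e, W w by exact: open_nbhs_nbhs.
have [W' [cW' oW' W'e W'S]] := compact_open_nbhs (filterI nQ (filterI nP nW)).
exists W'; split=> //.
- by exists (gran e) => //; rewrite sre; exact: ci_invariant.
- by move=> w /W'S[_ []].
- move=> b Bb _ _ /W'S[Qb _] /W'S[_ [Pb _]].
  have : set0 (gsrc b); last by [].
  rewrite -QP; split=> //; move: Qb.
  have -> : src (gran b) = ran b by apply/val_inj; rewrite /= gsrc_ran.
  by rewrite kK.
Qed.

Lemma separate_bisections W (s : seq (set G)) : compact W -> open W -> touches W ->
  (forall B, B \in s -> bisection B) ->
  exists W', [/\ compact W', open W', touches W', W' `<=` W &
    forall B, B \in s -> displaced W' B].
Proof.
move=> cW oW mW; elim: s => [_|B s IH sB]; first by exists W; split.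
have [|W1 [cW1 oW1 mW1 W1W W1s]] := IH.
  by move=> C Cs; apply: sB; rewrite inE Cs orbT.
have [W2 [cW2 oW2 mW2 W21 W2B]] := separate_bisection cW1 oW1 mW1 (sB B (mem_head _ _)).
exists W2; split=> // [|C]; first exact: subset_trans W1W.
rewrite inE => /orP[/eqP -> //|Cs] b Cb ub Db /W21 + /W21.
exact: (W1s C Cs b).
Qed.

End LocalReduction.

(** * Compressing functions to characteristic functions *)

Section Compression.
Variables (K : fieldType) (G : ampleHausdorffGroupoidType).
Implicit Types (f g x y : steinberg K G) (W B : set G) (a b c : G).

Lemma src_gran a : src (gran a) = ran a.
Proof. by apply/val_inj; rewrite /= gsrc_ran. Qed.

(** Multiplying by the characteristic function of a bisection around [a^-1] carries the value at [a]
    to the unit [gran a]. *)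
Lemma translate_to_units f a : f a != 0 -> exists x, (f ** x) (gran a) != 0.
Proof.
move=> fa; have [B [cB bB Ba]] := bisection_at (ginv a).
have [oB _ _] := bB; exists (steinberg_char K B).
rewrite (@rmul_point_right _ _ _ _ _ (ginv a)) ?gsrcV ?gsrc_ran//; last first.
  move=> b ba; rewrite steinberg_char_at//.
  case: (boolP (b \in B)) => [/set_mem Bb _|]; last by rewrite eqxx.
  by apply: bisection_src_inj bB Bb Ba _; rewrite ba gsrcV.
by rewrite ginvK gmul_ran steinberg_char_at// mem_set// mulr1.
Qed.

(** [g = f x] is nonzero at the unit [u]. A set of units around [u] on which [g] is constant is
    shrunk to a [W] displaced by all bisections of a cover of the support of [g]. Over [D],
    [1_W g 1_W] is then [g(u) 1_W]. *)
Lemma compress (D : closed_invariant G) f a : effective (reduction D) ->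
  ci_set D (src a) -> f a != 0 ->
  exists W x y, [/\ compact W, open W, W `<=` @units G, touches D W &
    forall b, ci_set D (src b) -> (x ** f ** y) b = steinberg_char K W b].
Proof.
move=> effD Da /translate_to_units[x fx]; pose g := f ** x; pose u := gran a.
have [lg cg] := (steinberg_predP _).1 (steinbergP g).
have nu : \forall w \near u, units w.
  by apply: open_nbhs_nbhs; split; [exact: units_open|exact: units_ran].
have [W0 [cW0 oW0 W0u W0S]] := compact_open_nbhs (filterI nu (lg u)).
have mW0 : touches D W0 by exists u => //; rewrite src_gran; exact: ci_invariant.
have [s sB Cs] := compact_bisection_cover cg.
have [|W [cW oW mW WW0 sepW]] := @separate_bisections _ _ effD W0 s cW0 oW0 mW0.
  by move=> B /sB[].
have Wu : W `<=` @units G by move=> w /WW0/W0S[].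
have cu := char_units (K := K) cW oW Wu.
exists W, (steinberg_scale (g u)^-1 (steinberg_char K W)), (x ** steinberg_char K W).
split=> // b Db.
rewrite rmulA -(rmulA _ f x) -/g rmul_units_right// rmul_units_left; last first.
  by move=> c /=; rewrite mulf_eq0 negb_or => /andP[_ /cu].
rewrite -[steinberg_scale _ _ _]/((g u)^-1 * steinberg_char K W (gran b)).
rewrite !steinberg_char_at//.
have [ub|nub] := pselect (units b).
  rewrite units_gran// units_gsrc//; case: (boolP (b \in W)) => [/set_mem Wb|_].
    by have [_ /= ->] := W0S _ (WW0 _ Wb); rewrite !mulr1 mulVf.
  by rewrite mulr0.
rewrite [b \in W](_ : _ = false); last by apply/negP => /set_mem/Wu.
have [->|gb] := eqVneq (g b) 0; first by rewrite mulr0 mul0r.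
have [B Bs Bb] := Cs b gb.
case: (boolP (gran b \in W)) => [/set_mem Wr|_]; last by rewrite mulr0 !mul0r.
case: (boolP (gsrc b \in W)) => [/set_mem Ws|_]; last by rewrite mulr0.
by case: (sepW B Bs b Bb nub Db Wr Ws).
Qed.

End Compression.

(** * Ideals and their open invariant supports *)

Section IdealSupport.
Variables (K : fieldType) (G : ampleHausdorffGroupoidType).
Variable I : ideal (steinberg K G).
Implicit Types (f g x y : steinberg K G) (W B : set G) (a b c : G).

Lemma idealB f g : ideal_set I f -> ideal_set I g -> ideal_set I (f - g).
Proof. by have [[_ IB] _] := ideal_left I; exact: IB. Qed.

Lemma idealD f g : ideal_set I f -> ideal_set I g -> ideal_set I (f + g).
Proof.
move=> If Ig; rewrite -[g]opprK; apply: idealB => //; rewrite -sub0r.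
by apply: idealB => //; have [[]] := ideal_left I.
Qed.

Lemma ideal_mull f g : ideal_set I g -> ideal_set I (f ** g).
Proof. by have [_ Il] := ideal_left I; exact: Il. Qed.

Lemma ideal_mulr f g : ideal_set I f -> ideal_set I (f ** g).
Proof. by have [_ Ir] := ideal_right I; exact: Ir. Qed.

(** Only functions supported on units are allowed: multiplication by them is pointwise, so
    characteristic functions can be recovered from them. *)
Definition ideal_support : set (unit_space G) := [set u | exists f,
  [/\ ideal_set I f, forall a, f a != 0 -> units a & f (\val u) != 0]].

(** Around [u] the function [f] is a nonzero constant on a compact open set [W] of units;
    multiplying it by a scaled [1_W] gives [1_W]. *)
Lemma ideal_support_char u : ideal_support u -> exists W,
  [/\ compact W, open W, W `<=` @units G, W (\val u) & ideal_set I (steinberg_char K W)].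
Proof.
move=> [f [If fu fu0]]; have [lf _] := (steinberg_predP _).1 (steinbergP f).
have nu : \forall w \near \val u, units w.
  by apply: open_nbhs_nbhs; split; [exact: units_open|exact: set_valP].
have [W [cW oW Wu WS]] := compact_open_nbhs (filterI nu (lf (\val u))).
have Wun : W `<=` @units G by move=> w /WS[].
exists W; split=> //.
rewrite [steinberg_char K W](_ : _ =
    steinberg_scale (f (\val u))^-1 (steinberg_char K W) ** f).
  exact: ideal_mull.
apply: steinberg_ext => a; rewrite rmul_units_right//.
rewrite -[steinberg_scale _ _ _]/(_^-1 * steinberg_char K W a) steinberg_char_at//.
case: (boolP (a \in W)) => [/set_mem Wa|_]; last by rewrite mulr0 mul0r.
by have [ua /= fa] := WS a Wa; rewrite mulr1 units_gsrc// fa mulVf.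
Qed.

Lemma ideal_support_open : open ideal_support.
Proof.
rewrite openE => u [f [If fun_ fu]]; rewrite /interior.
have [lf _] := (steinberg_predP _).1 (steinbergP f).
have := @val_continuous _ _ u _ (lf (\val u)).
rewrite /= nbhs_simpl /=; apply: filterS => w /= fw.
by exists f; rewrite fw.
Qed.

(** [f] is multiplied on the left by [1_B], for a neighbourhood [B] of [a], and on the right by
    [1_C], for a bisection [C] containing the inverses of [B]. The product is supported on units and
    takes at [gran a] the value of [f] at [gsrc a]. *)
Lemma ideal_support_invariant : Defs.invariant ideal_support.
Proof.
move=> a [f [If fun_ fa]].
have [C [cC bC Ca]] := bisection_at (ginv a).
have [oC _ _] := bC.
have nC : \forall b \near a, C (ginv b).
  by apply: (@ginv_continuous G); apply: open_nbhs_nbhs.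
have [B0 [cB0 bB0 B0a]] := bisection_at a; have [oB0 _ _] := bB0.
have nB0 : nbhs a B0 by exact: open_nbhs_nbhs.
have [B [cB oB Ba BS]] := compact_open_nbhs (filterI nC nB0).
have CE b : steinberg_char K C b != 0 -> C b.
  rewrite steinberg_char_at//.
  by case: (boolP (b \in C)) => [/set_mem//|]; rewrite eqxx.
have BE b : (steinberg_char K B ** f) b != 0 -> B b.
  rewrite rmul_units_right// steinberg_char_at//.
  by case: (boolP (b \in B)) => [/set_mem//|]; rewrite mul0r eqxx.
exists (steinberg_char K B ** f ** steinberg_char K C); split.
- by apply/ideal_mulr/ideal_mull.
- move=> b /convolution_neq0[c [cb /BE Bc /CE Cc]].
  have e : gmul (ginv c) b = ginv c.
    have [Cc' _] := BS c Bc.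
    apply: (bisection_ran_inj bC) => //.
    by rewrite granM// gsrcV.
  by rewrite -[b](@gmulVK _ c) // e; exact: units_ran.
- rewrite -[\val (ran a)]/(gran a).
  rewrite (@rmul_point_right _ _ _ _ _ (ginv a)) ?gsrcV ?gsrc_ran//; last first.
    move=> b ba /CE Cb; apply: bisection_src_inj bC Cb Ca _.
    by rewrite ba gsrcV.
  rewrite ginvK gmul_ran rmul_units_right// !steinberg_char_at//.
  by rewrite !mem_set// mulr1 mul1r.
Qed.

Definition ideal_open : open_invariant G :=
  OpenInvariant ideal_support_open ideal_support_invariant.

(** The support is covered by sets [s^-1(W)] with [1_W] in the ideal. Each [f 1_W] is in the ideal,
    and subtracting it removes [W] from the cover. *)
Lemma ideal_vanishing f :
  (forall a, ci_set (open_invariantC ideal_open) (src a) -> f a = 0) -> ideal_set I f.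
Proof.
move=> fD; have [_ cf] := (steinberg_predP _).1 (steinbergP f).
pose P := [set W : set G |
  [/\ compact W, open W, W `<=` @units G & ideal_set I (steinberg_char K W)]].
have [|s sP fs] := @compact_seq_cover _ _ P (fun W => @gsrc G @^-1` W) _ cf.
  move=> a /= fa; have Ua : ideal_support (src a).
    by apply: contrapT => /fD; apply/eqP.
  have [W [cW oW Wu Wa IW]] := ideal_support_char Ua.
  exists W; split=> //; apply: open_comp => // b _; exact: gsrc_continuous.
elim: s f {fD cf} sP fs => [|W s IH] f sP fs.
  rewrite [f](_ : _ = 0); first by have [[]] := ideal_left I.
  apply: steinberg_ext => a; have [//|/fs[]//] := eqVneq (f a) 0.
have [cW oW Wu IW] := sP W (mem_head _ _).
have -> : f = f ** steinberg_char K W + (f - f ** steinberg_char K W).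
  by rewrite addrC subrK.
apply: idealD; first exact: ideal_mull.
apply: IH => [C Cs|a ga]; first by apply: sP; rewrite inE Cs orbT.
have : (f - f ** steinberg_char K W) a != 0 := ga.
rewrite steinbergBE rmul_units_right; last exact: char_units.
rewrite steinberg_char_at//; case: (boolP (gsrc a \in W)) => [_|aW].
  by rewrite mulr1 subrr eqxx.
rewrite mulr0 subr0 => /fs[C]; rewrite inE => /orP[/eqP ->|Cs Ca]; last by exists C.
by move=> Wa; case/negP: aW; exact: mem_set.
Qed.

(** If some [f] in the ideal did not vanish over the complement of the support, some [x f y] would
    agree there with a [1_W] for which [W] meets this complement. The difference lies in [I] by
    [ideal_vanishing], hence so does [1_W], which puts a point of the complement into the
    support. *)
Lemma ideal_vanishingP f : strongly_effective G ->
  ideal_set I f <-> forall a, ci_set (open_invariantC ideal_open) (src a) -> f a = 0.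
Proof.
move=> sG; split=> [If a Da|]; last exact: ideal_vanishing.
apply: contrapT => /eqP fa; have effD : effective (reduction (open_invariantC ideal_open)).
  by apply: sG; exists (src a).
have [W [x [y [cW oW Wu [w Ww Dw] xfy]]]] := compress effD Da fa.
suff IW : ideal_set I (steinberg_char K W).
  apply: Dw; exists (steinberg_char K W); split=> //; first exact: char_units.
  by rewrite -[\val (src w)]/(gsrc w) units_gsrc ?steinberg_char_at ?mem_set ?oner_eq0//; exact: Wu.
rewrite -[steinberg_char K W](subKr (x ** f ** y)); apply: idealB.
  by apply/ideal_mulr/ideal_mull.
by apply: ideal_vanishing => b Db; rewrite steinbergBE xfy// subrr.
Qed.

End IdealSupport.

(** * Passing between [A_K(G)], its quotients and [A_K(G_D)] *)

Section Transfer.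
Variables (K : fieldType) (G : ampleHausdorffGroupoidType).
Implicit Types (f g h : steinberg K G).

Lemma rmul_units_id_left h f : (forall a, h a != 0 -> units a) ->
  (forall a, f a != 0 -> h (gran a) = 1) -> h ** f = f.
Proof.
move=> hu hf; apply: steinberg_ext => a; rewrite rmul_units_left//.
by have [->|/hf ->] := eqVneq (f a) 0; rewrite ?mulr0 ?mul1r.
Qed.

Lemma rmul_units_id_right h f : (forall a, h a != 0 -> units a) ->
  (forall a, f a != 0 -> h (gsrc a) = 1) -> f ** h = f.
Proof.
move=> hu hf; apply: steinberg_ext => a; rewrite rmul_units_right//.
by have [->|/hf ->] := eqVneq (f a) 0; rewrite ?mul0r ?mulr1.
Qed.

Lemma factors_res (D : closed_invariant G) f b c : factors f (diag2 b c) ->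
  factors (steinberg_res D f) (diag2 (steinberg_res D b) (steinberg_res D c)).
Proof.
move=> [z [w zw]]; exists (steinberg_res D \o z), (steinberg_res D \o w) => i j.
rewrite /= -!steinberg_resM zw /diag2.
by case: (i == j); [case: i|exact: steinberg_ext].
Qed.

(** The hypothesis makes [I] the kernel of restriction, which is surjective; so a relation in
    [A_K(G_D)] lifts entry by entry and holds modulo [I]. *)
Lemma infinite_quotient_of_res (D : closed_invariant G)
    (I : ideal (steinberg K G)) f :
  (forall g, ideal_set I g <-> forall a, ci_set D (src a) -> g a = 0) ->
  infinite_elt (steinberg_res D f) -> infinite_elt (rng_pi I f).
Proof.
move=> IE /infinite_eltP[f0 [x x0 [z [w zw]]]].
have resE g g' : steinberg_res D g = steinberg_res D g' <->
    rng_pi I g = rng_pi I g'.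
  split=> [/steinberg_res_eqP gg'|/rng_pi_eq/IE gg'].
    by apply/rng_pi_eq/IE => a Da; rewrite steinbergBE gg'// subrr.
  by apply/steinberg_res_eqP => a /gg'; rewrite steinbergBE => /eqP; rewrite subr_eq0 => /eqP.
have res0 : steinberg_res D (0 : steinberg K G) = 0 by exact: steinberg_ext.
have neq0 g : steinberg_res D g != 0 -> rng_pi I g != 0.
  by apply: contra_neq; rewrite -(rng_pi0 I) -res0 => /resE.
apply/infinite_eltP; split; first exact: neq0.
have [x' x'E] := steinberg_res_surj x.
exists (rng_pi I x'); first by apply: neq0; rewrite x'E.
have [z' z'E] := choice (fun i => steinberg_res_surj (z i)).
have [w' w'E] := choice (fun i => steinberg_res_surj (w i)).
exists (rng_pi I \o z'), (rng_pi I \o w') => i j; rewrite /= !quot_rmul.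
have -> : diag2 (rng_pi I f) (rng_pi I x') i j = rng_pi I (diag2 f x' i j).
  by rewrite /diag2; case: (i == j); [case: i|rewrite rng_pi0].
apply/resE; rewrite !steinberg_resM z'E w'E zw -x'E /diag2.
by case: (i == j); [case: i|rewrite res0].
Qed.

End Transfer.

(** * Characteristic functions of compact, relatively open subsets of [D] *)

Section ReductionChar.
Variables (K : fieldType) (G : ampleHausdorffGroupoidType).
Variables (D : closed_invariant G) (V : set (unit_space G)).
Hypotheses (VD : V `<=` ci_set D) (cV : compact V).
Hypothesis oV : open (V : set (subspace (ci_set D))).

Lemma reduction_char_neq0 (a : reduction D) :
  reduction_char K D V a != 0 <-> (\val @` V) (\val a).
Proof.
rewrite reduction_charE//; split=> [|Va]; last by rewrite mem_set// oner_eq0.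
by case: (boolP (_ \in _)) => [/set_mem//|]; rewrite eqxx.
Qed.

Lemma reduction_char_eq1 (a : reduction D) :
  (\val @` V) (\val a) -> reduction_char K D V a = 1.
Proof. by move=> Va; rewrite reduction_charE// mem_set. Qed.

Lemma units_reduction (a : reduction D) : units (\val a) -> units a.
Proof.
move=> ua; suff <- : gsrc a = a by exact: units_src.
by apply: val_inj; rewrite val_gsrc units_gsrc.
Qed.

Lemma reduction_char_units (a : reduction D) :
  reduction_char K D V a != 0 -> units a.
Proof.
by move=> /reduction_char_neq0[u _ ua]; apply: units_reduction; rewrite -ua; exact: set_valP.
Qed.

Lemma reduction_char_idempotent : idempotent_elt (reduction_char K D V).
Proof.
apply: rmul_units_id_left; first exact: reduction_char_units.
move=> a /[dup] /reduction_char_units ua /reduction_char_neq0 Va.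
by apply: reduction_char_eq1; rewrite units_gran.
Qed.

(** The restriction of [1_B] is a nonzero idempotent below [1_V]. It is properly infinite because
    restriction respects products. *)
Lemma reduction_char_infinite (B : set (unit_space G)) :
  compact B -> open B -> B `&` ci_set D !=set0 -> B `&` ci_set D `<=` V ->
  properly_infinite_elt (unit_char K B) -> infinite_elt (reduction_char K D V).
Proof.
move=> cB oB [u [Bu Du]] BDV /properly_infinite_eltP[_ piB].
set p := steinberg_res D (unit_char K B).
have pE (a : reduction D) : p a = ((\val a : G) \in \val @` B)%:R.
  by rewrite -[p a]/(unit_char K B (\val a)) unit_charE.
have pV (a : reduction D) : p a != 0 -> (\val @` V) (\val a).
  rewrite pE; case: (boolP (_ \in _)) => [/set_mem[w Bw wa] _|]; last by rewrite eqxx.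
  exists w => //; apply: BDV; split=> //.
  have -> : w = src (\val a).
    by apply/val_inj; rewrite -wa /= units_gsrc//; exact: set_valP.
  exact: reductionP.
have pu (a : reduction D) : p a != 0 -> units a.
  by move=> /pV[w _ wa]; apply: units_reduction; rewrite -wa; exact: set_valP.
have pp : idempotent_elt p.
  apply: rmul_units_id_left => // a pa; rewrite units_gran; last exact: pu.
  by move: pa; rewrite pE; case: (_ \in _); rewrite ?eqxx.
apply: (infinite_over_properly_infinite pp reduction_char_idempotent).
- apply: rmul_units_id_right; first exact: reduction_char_units.
  by move=> a pa; apply: reduction_char_eq1; rewrite units_gsrc; [exact: pV|exact: pu].
- apply: rmul_units_id_left; first exact: reduction_char_units.
  by move=> a pa; apply: reduction_char_eq1; rewrite units_gran; [exact: pV|exact: pu].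
apply/properly_infinite_eltP; split; last exact: factors_res.
have uD : \val u \in @src G @^-1` ci_set D.
  apply/mem_set => /=; have -> // : src (\val u) = u.
  by apply/val_inj; rewrite /= units_gsrc//; exact: set_valP.
apply/eqP => /(congr1 (fun h : steinberg K (reduction D) => h (exist _ (\val u) uD))).
rewrite pE mem_set; last by exists u.
by apply/eqP; rewrite oner_eq0.
Qed.

End ReductionChar.

(** * The implications between the four conditions *)

Section Implications.
Variables (K : fieldType) (G : ampleHausdorffGroupoidType).

Lemma unit_char_neq0 (V : set (unit_space G)) :
  V !=set0 -> compact V -> open V -> unit_char K V != 0.
Proof.
move=> [u Vu] cV oV; apply/eqP => /(congr1 (fun f : steinberg K G => f (\val u))).
rewrite unit_charE// mem_set; last by exists u.
by apply/eqP; rewrite oner_eq0.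
Qed.

Lemma infinite_idempotent_in_one_sided_ideal (sG : strongly_effective G) :
  (forall (U : open_invariant G) (V : set (unit_space G)),
    V !=set0 -> V `<=` ~` oi_set U -> compact V ->
    open (V : set (subspace (~` oi_set U))) ->
    infinite_elt (reduction_char K (open_invariantC U) V)) ->
  forall (I : ideal (steinberg K G)) (J : set (rng_quotient I)),
    left_ideal J \/ right_ideal J -> (exists2 x, J x & x != 0) ->
    exists2 e, J e & idempotent_elt e /\ infinite_elt e.
Proof.
move=> infV I J JI [q Jq q0].
pose D := open_invariantC (ideal_open I).
have IE f : ideal_set I f <-> forall a, ci_set D (src a) -> f a = 0.
  exact: ideal_vanishingP.
pose f : steinberg K G := repr (q : Quotient.quot (ideal_pred I)).
have fE : rng_pi I f = q by exact: rng_piK.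
have [a Da fa] : exists2 a, ci_set D (src a) & f a != 0.
  apply: contrapT => nf; case/negP: q0; rewrite -fE -(rng_pi0 I); apply/eqP.
  apply/rng_pi_eq; rewrite subr0; apply/IE => a Da; apply: contrapT => /eqP fa.
  by apply: nf; exists a.
have effD : effective (reduction D) by apply: sG; exists (src a).
have [W [x [y [cW oW Wu [w Ww Dw] xfy]]]] := compress effD Da fa.
pose p := rng_pi I (steinberg_char K W).
have xfyE : rng_pi I (x ** f ** y) = p.
  by apply/rng_pi_eq/IE => b Db; rewrite steinbergBE xfy// subrr.
have pp : idempotent_elt p.
  by rewrite /idempotent_elt quot_rmul char_idempotent.
have pinf : infinite_elt p.
  apply: (infinite_quotient_of_res IE).
  (* [V] is the trace of [W] on [D], so that restricting [1_W] gives its characteristic function and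
     [infV] applies. *)
  pose V : set (unit_space G) := (\val @^-1` W) `&` ci_set D.
  have VE : \val @` V = W `&` (@src G @^-1` ci_set D).
    apply/seteqP; split=> [_ [u [Wu' Du] <-]|b [Wb Db]].
      split=> //=; have -> // : src (\val u) = u.
      by apply/val_inj; rewrite /= units_gsrc//; exact: set_valP.
    have bE : \val (src b) = b by rewrite /= units_gsrc//; exact: Wu.
    by exists (src b) => //; split=> //=; rewrite -[X in W X]/(\val (src b)) bE.
  have VD : V `<=` ci_set D by move=> u [].
  have cV : compact V.
    apply/compact_set_type; rewrite VE; apply: compact_closedI => //.
    by apply: preimage_closed; [move=> b _; exact: src_continuous|exact: ci_closed].
  have oV : open (V : set (subspace (ci_set D))).
    apply/open_subspaceP; exists (\val @^-1` W); last by rewrite /V -setIA setIid.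
    by apply: open_comp => // b _; exact: val_continuous.
  rewrite (_ : steinberg_res D _ = reduction_char K D V).
    apply: infV => //; exists (src w); split=> //=.
    by rewrite -[X in W X]/(gsrc w) units_gsrc//; exact: Wu.
  apply: steinberg_ext => b; rewrite reduction_charE// VE.
  rewrite -[LHS]/(steinberg_char K W (\val b)) steinberg_char_at//.
  congr (_%:R); congr nat_of_bool; apply/idP/idP => /set_mem Wb; apply/mem_set.
    by split=> //; exact: reductionP.
  by case: Wb.
(* Modulo the ideal, [p = x f y]. Bracketed as [(x f) y] for a left ideal and as [x (f y)] for a
   right one, it is equivalent to an idempotent [t p s] inside [J]. *)
have [s [t [st Jts]]] : exists s t, s ** t = p /\ forall z, J (t ** z ** s).
  case: JI => -[_ Jm].
    exists (rng_pi I x ** rng_pi I f), (rng_pi I y); split.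
      by rewrite !quot_rmul.
    by move=> z; apply: (Jm); apply: (Jm); rewrite fE.
  exists (rng_pi I x), (rng_pi I f ** rng_pi I y); split.
    by rewrite !quot_rmul rmulA.
  by move=> z; apply: (Jm); apply: (Jm); apply: (Jm); rewrite fE.
exists (t ** p ** s) => //.
exact: infinite_idem_equiv.
Qed.

End Implications.

Theorem theorem3p4 (K : fieldType) (G : ampleHausdorffGroupoidType)
    (sG : strongly_effective G)
    (B : set (set (unit_space G))) (basisB : basis B)
    (cB : forall V, B V -> V !=set0 /\ compact V) :
  let P1 := properly_purely_infinite (steinberg K G) in
  let P2 := forall V, B V -> properly_infinite_elt (unit_char K V) in
  let P3 := forall (U : open_invariant G) (V : set (unit_space G)),
    V !=set0 -> V `<=` ~` oi_set U -> compact V ->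
    open (V : set (subspace (~` oi_set U))) ->
    idempotent_elt (reduction_char K (open_invariantC U) V) /\
    infinite_elt (reduction_char K (open_invariantC U) V) in
  let P4 := forall (I : ideal (steinberg K G)) (J : set (rng_quotient I)),
    left_ideal J \/ right_ideal J -> (exists2 x, J x & x != 0) ->
    exists2 e, J e & idempotent_elt e /\ infinite_elt e in
  [<-> P1; P2; P3; P4] /\
  (P1 \/ P2 \/ P3 \/ P4 -> purely_infinite (steinberg K G)).
Proof.
move=> P1 P2 P3 P4; have [oB nbhsB] := basisB.
have P12 : P1 -> P2.
  move=> p1 V BV; apply: p1; have [V0 cV] := cB _ BV.
  by apply: unit_char_neq0 => //; exact: oB.
have P23 : P2 -> P3.
  move=> p2 U V [u Vu] VD cV oV; split; first exact: reduction_char_idempotent.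
  have [V' oV' V'V] := (open_subspaceP _ _).1 oV.
  have VV' v : (V' v /\ (~` oi_set U) v) = (V v /\ (~` oi_set U) v).
    exact: (congr1 (@^~ v) V'V).
  have V'u : V' u by have [] : V' u /\ (~` oi_set U) u; [rewrite VV'; split=> //; exact: VD|].
  (* [C] lies in an open extension [V'] of [V], so its trace on the complement of [U] lies in [V];
     the trace contains [u]. *)
  have [C [BC Cu] CV'] := nbhsB u V' (open_nbhs_nbhs (conj oV' V'u)).
  have [_ cC] := cB _ BC.
  apply: (@reduction_char_infinite K G (open_invariantC U) V VD cV oV C) => //.
  - exact: oB.
  - by exists u; split=> //; exact: VD.
  - move=> v [/CV' V'v Dv]; suff [] : V v /\ (~` oi_set U) v by [].
    by rewrite -VV'.
  - exact: p2.
have P34 : P3 -> P4.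
  move=> p3; apply: infinite_idempotent_in_one_sided_ideal => // U V V0 VD cV oV.
  by have [] := p3 U V V0 VD cV oV.
have P41 : P4 -> P1.
  move=> p4; apply: properly_purely_infinite_of_idempotents.
    exact: steinberg_local_unit.
  by move=> I J rJ; apply: p4; right.
split; first by tfae.
move=> P; apply: properly_purely_infinite_purely_infinite.
by case: P => [//|[/P23/P34|[/P34|]]] /P41.
Qed.
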